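(* Let $t\geq 2$ and $0\leq z\leq t-1$ be integers, let $x$ be an indeterminate, and let $\rho_1,\rho_2$ be functions defined on $\mathbb{N}$ (with values in a commutative ring, e.g. $\mathbb{C}$). Define the formal power series $$f_t(q):=\sum_{\lambda\in\mathcal P}q^{|\lambda|}\prod_{h\in\mathcal H(\lambda)}\rho_1(th)^2,\qquad g_t(q):=\sum_{\lambda\in\mathcal P}q^{|\lambda|}\prod_{h\in\mathcal H(\lambda)}\rho_1(th)^2\sum_{h\in\mathcal H(\lambda)}\rho_2(th).$$ Then $$\sum_{\lambda\in\mathrm{BG}_{z,t}}q^{|\lambda|}x^{|\mathcal H_t(\lambda)|}\prod_{h\in\mathcal H_t(\lambda)}\rho_1(h)\sum_{h\in\mathcal H_t(\lambda)}\rho_2(h) =2\left\lfloor\tfrac{t-z}{2}\right\rfloor\bigl(f_t(x^2q^{2t})\bigr)^{\lfloor\frac{t-z}{2}\rfloor-1}g_t(x^2q^{2t})\prod_{i=0}^{\lfloor (t-z)/2\rfloor-1}(-q^{2i+z+1},-q^{2t-2i-z-1},q^{2t};q^{2t})_\infty.$$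
   Context: $\mathcal P$ is the set of integer partitions, $|\lambda|$ the weight. For a box $v$ of the Ferrers diagram of $\lambda$, the hook length is $1$ plus the number of boxes strictly right of $v$ in its row plus the number strictly below $v$ in its column. $\mathcal H(\lambda)$ is the multiset of all hook lengths of $\lambda$, and $\mathcal H_t(\lambda)$ the multiset of those hook lengths divisible by $t$; $|\mathcal H_t(\lambda)|$ is its cardinality (with multiplicity). Every partition can be written in Frobenius notation $\lambda=\begin{pmatrix}\alpha_1&\cdots&\alpha_d\\ \beta_1&\cdots&\beta_d\end{pmatrix}$ with $d$ the Durfee square size, $\alpha_1>\dots>\alpha_d\ge0$, $\beta_1>\dots>\beta_d\ge 0$, $\alpha_i=\lambda_i-i$, $\beta_i=\lambda'_i-i$ ($\lambda'$ the conjugate). For an integer $z$, $\mathcal P_z$ ($z$-asymmetric partitions) is the set of partitions whose Frobenius notation has the form $\begin{pmatrix}a_1+z&\cdots&a_d+z\\ a_1&\cdots&a_d\end{pmatrix}$. For $t\ge2$ and $0\le z\le t-1$, $\mathrm{BG}_{z,t}$ is the set of $\lambda\in\mathcal P_z$ such that, for all $1\le j\le d$ and $1\le k\le z$, $(a_j+k)/t\notin\mathbb N$ and $(2a_j+z+1)/t\notin 2\mathbb N+1$. The $q$-Pochhammer symbols are $(a;q)_\infty=\prod_{j\ge0}(1-aq^j)$ and $(a_1,\dots,a_m;q)_\infty=\prod_i(a_i;q)_\infty$; an empty product equals $1$. *)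

(* Defs.v *)
From HB Require Import structures.
From mathcomp Require Import all_boot all_algebra.
From mathcomp Require Import boolp.

Set Implicit Arguments.
Unset Strict Implicit.
Unset Printing Implicit Defensive.

Import GRing.Theory.

(* Partitions are finite nonincreasing sequences of positive parts.  Rows and
   columns of the Ferrers diagram are numbered from 0. *)

Definition is_partition (s : seq nat) : bool :=
  sorted geq s && (0 \notin s).

(* Partitions of n with all parts <= k; the first argument is fuel. *)
Fixpoint partitions_rec (fuel k n : nat) : seq (seq nat) :=
  if n is 0 then [:: [::]] else
  if fuel is fuel'.+1 then
    flatten [seq [seq p :: s | s <- partitions_rec fuel' p (n - p)]
            | p <- iota 1 (minn k n)]
  else [::].

Definition partitions (n : nat) : seq (seq nat) := partitions_rec n n n.

Lemma is_partition_cons p s :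
  is_partition (p :: s) = [&& 0 < p, head 0 s <= p & is_partition s].
Proof.
rewrite /is_partition inE negb_or eq_sym -lt0n.
case: s => [|r s] /=; first by rewrite andbT.
rewrite /geq /=; case: (0 < p); case: (r <= p) => //=; by rewrite andbF.
Qed.

Lemma mem_partitions_rec fuel k n s : n <= fuel ->
  (s \in partitions_rec fuel k n) =
  [&& is_partition s, head 0 s <= k & sumn s == n].
Proof.
have base k' u : (u \in [:: [::]]) =
    [&& is_partition u, head 0 u <= k' & sumn u == 0].
  case: u => [|p u] //; rewrite inE is_partition_cons /= addn_eq0.
  by case: p => [|p]; rewrite ?andbF.
elim: fuel k n s => [|fuel IH] k [|n] s //= le_n; try exact: base.
apply/flatten_mapP/idP => [[p]|].
  rewrite mem_iota add1n ltnS leq_min => /and3P[p0 pk pn] /mapP[r].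
  rewrite IH; last by case: (p) p0 => // p' _; rewrite subSS (leq_trans (leq_subr _ _)).
  move=> /and3P[pr hr /eqP sr] ->.
  by rewrite is_partition_cons p0 hr pr pk /= sr subnKC ?eqxx.
case: s => [|p s] /and3P[]; first by rewrite /= => _ _ /eqP.
rewrite is_partition_cons => /and3P[p0 hs ps] /= pk /eqP E.
have pn : p <= n.+1 by rewrite -E leq_addr.
exists p; first by rewrite mem_iota add1n ltnS leq_min p0 pk pn.
apply/mapP; exists s => //.
rewrite IH; last by case: (p) p0 => // p' _; rewrite subSS (leq_trans (leq_subr _ _)).
by rewrite ps hs -E addKn eqxx.
Qed.

Lemma mem_partitions n s :
  (s \in partitions n) = is_partition s && (sumn s == n).
Proof.
rewrite mem_partitions_rec //; case: is_partition; case: eqP => //=.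
  by case: s => [|p s] //= <-; rewrite leq_addr.
by rewrite andbF.
Qed.

Lemma partitions_rec_uniq fuel k n : uniq (partitions_rec fuel k n).
Proof.
elim: fuel k n => [|fuel IH] k [|n] //=.
apply: (@allpairs_uniq_dep _ _ _ (fun p s => p :: s)) => //.
- exact: iota_uniq.
- move=> [p s] [r u] _ _ /= [-> ->] //.
Qed.

Lemma partitions_uniq n : uniq (partitions n).
Proof. exact: partitions_rec_uniq. Qed.

Definition diagram (s : seq nat) : seq (nat * nat) :=
  [seq (i, j) | i <- iota 0 (size s), j <- iota 0 (nth 0 s i)].

Definition hook_length (s : seq nat) (v : nat * nat) : nat :=
  1 + count (fun u => (u.1 == v.1) && (v.2 < u.2)) (diagram s)
    + count (fun u => (u.2 == v.2) && (v.1 < u.1)) (diagram s).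

Definition hooks (s : seq nat) : seq nat :=
  [seq hook_length s v | v <- diagram s].

Definition hooks_mult (t : nat) (s : seq nat) : seq nat :=
  [seq h <- hooks s | t %| h].

Definition conjugate (s : seq nat) : seq nat :=
  [seq count (fun p => j < p) s | j <- iota 0 (head 0 s)].

(* The d x d square fits in the diagram iff the first d rows have length >= d. *)
Definition durfee (s : seq nat) : nat :=
  \max_(d < (size s).+1 | all (leq d) (take d s)) d.

Definition frobenius_alpha (s : seq nat) : seq nat :=
  [seq nth 0 s i - i.+1 | i <- iota 0 (durfee s)].

Definition frobenius_beta (s : seq nat) : seq nat :=
  [seq nth 0 (conjugate s) i - i.+1 | i <- iota 0 (durfee s)].

Definition asymmetric (z : nat) (s : seq nat) : bool :=
  frobenius_alpha s == [seq a + z | a <- frobenius_beta s].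

Definition BG (z t : nat) (s : seq nat) : bool :=
  asymmetric z s &&
  all (fun a =>
         all (fun k => ~~ (t %| a + k)) (iota 1 z) &&
         ~~ ((t %| 2 * a + z + 1) && odd ((2 * a + z + 1) %/ t)))
      (frobenius_beta s).

(* Formal power series: f n is the coefficient of q^n. *)

Local Open Scope ring_scope.

Record fps (A : Type) := FPS { fps_coef :> nat -> A }.

Lemma fpsP (A : Type) (f g : fps A) : f =1 g <-> f = g.
Proof. by split=> [|-> //]; case: f g => [f] [g] /= /funext ->. Qed.

HB.instance Definition _ (A : Type) := gen_eqMixin (fps A).
HB.instance Definition _ (A : Type) := gen_choiceMixin (fps A).

Section FpsRing.
Variable A : comNzRingType.
Implicit Types f g h : fps A.

Definition fps_zero : fps A := FPS (fun=> 0).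
Definition fps_opp f : fps A := FPS (fun n => - f n).
Definition fps_add f g : fps A := FPS (fun n => f n + g n).
Definition fps_one : fps A := FPS (fun n => (n == 0%N)%:R).
Definition fps_mul f g : fps A :=
  FPS (fun n => \sum_(i < n.+1) f i * g (n - i)%N).

Fact fps_addA : associative fps_add.
Proof. by move=> f g h; apply/fpsP => n /=; rewrite addrA. Qed.
Fact fps_addC : commutative fps_add.
Proof. by move=> f g; apply/fpsP => n /=; rewrite addrC. Qed.
Fact fps_add0 : left_id fps_zero fps_add.
Proof. by move=> f; apply/fpsP => n /=; rewrite add0r. Qed.
Fact fps_addN : left_inverse fps_zero fps_opp fps_add.
Proof. by move=> f; apply/fpsP => n /=; rewrite addNr. Qed.

HB.instance Definition _ :=
  GRing.isZmodule.Build (fps A) fps_addA fps_addC fps_add0 fps_addN.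

Definition fps_trunc n f : {poly A} := \poly_(i < n.+1) f i.

Lemma fps_mul_poly n (f g : fps A) (p r : {poly A}) :
    (forall i, (i <= n)%N -> p`_i = f i) ->
    (forall i, (i <= n)%N -> r`_i = g i) ->
  (p * r)`_n = fps_mul f g n.
Proof.
move=> pf rg; rewrite coefM /=; apply: eq_bigr => i _.
by rewrite pf ?rg ?leq_subr // -ltnS.
Qed.

Lemma coef_fps_trunc n (f : fps A) i : (i <= n)%N -> (fps_trunc n f)`_i = f i.
Proof. by move=> le_in; rewrite coef_poly ltnS le_in. Qed.

Lemma coef_fps_truncM n (f g : fps A) i : (i <= n)%N ->
  (fps_trunc n f * fps_trunc n g)`_i = fps_mul f g i.
Proof.
by move=> le_in; apply: fps_mul_poly => j le_ji;
  apply: coef_fps_trunc; apply: leq_trans le_in.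
Qed.

Fact fps_mulA : associative fps_mul.
Proof.
move=> f g h; apply/fpsP => n.
rewrite -(@fps_mul_poly n f (fps_mul g h)
           (fps_trunc n f) (fps_trunc n g * fps_trunc n h)).
- rewrite mulrA; apply: fps_mul_poly => i le_in.
  + exact: coef_fps_truncM.
  + exact: coef_fps_trunc.
- by move=> i; apply: coef_fps_trunc.
- by move=> i; apply: coef_fps_truncM.
Qed.
Fact fps_mulC : commutative fps_mul.
Proof.
by move=> f g; apply/fpsP => n; rewrite -!(@coef_fps_truncM n) // mulrC.
Qed.
Fact fps_mul1 : left_id fps_one fps_mul.
Proof.
move=> f; apply/fpsP => n /=; rewrite big_ord_recl /= mul1r subn0 big1 ?addr0 //.
by move=> i _; rewrite mul0r.
Qed.
Fact fps_mulDl : left_distributive fps_mul fps_add.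
Proof.
move=> f g h; apply/fpsP => n /=; rewrite -big_split /=.
by apply: eq_bigr => i _; rewrite mulrDl.
Qed.
Fact fps_one_neq0 : fps_one != fps_zero.
Proof. by apply/eqP => /fpsP/(_ 0%N)/eqP; rewrite /= oner_eq0. Qed.

HB.instance Definition _ :=
  GRing.Zmodule_isComNzRing.Build (fps A)
    fps_mulA fps_mulC fps_mul1 fps_mulDl fps_one_neq0.

Definition fpsC (c : A) : fps A := FPS (fun n => if n == 0%N then c else 0).
Definition fpsX : fps A := FPS (fun n => (n == 1%N)%:R).

Lemma coef_fpsM f g n : (f * g) n = \sum_(i < n.+1) f i * g (n - i)%N.
Proof. by []. Qed.

Lemma coef_fpsX_exp (p : fps A) j n : p 0%N = 0 -> (n < j)%N -> (p ^+ j) n = 0.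
Proof.
move=> p0; elim: j n => // j IH n lt_nj.
rewrite exprS coef_fpsM big1 // => -[[|i] /= lt_in] _; first by rewrite p0 mul0r.
rewrite (IH (n - i.+1)%N) ?mulr0 //.
by case: n lt_nj lt_in => // n; rewrite subSS !ltnS => *; apply: leq_ltn_trans (leq_subr _ _) _.
Qed.

(* (a; p)_oo = prod_(j >= 0) (1 - a p^j), for p with zero constant term: the
   factors with j > n are 1 modulo q^(n+1), see [qpochE]. *)
Definition qpoch (a p : fps A) : fps A :=
  FPS (fun n => (\prod_(j < n.+1) (1 - a * p ^+ j)) n).

Lemma qpochE (a p : fps A) n N : p 0%N = 0 -> (n < N)%N ->
  (\prod_(j < N) (1 - a * p ^+ j)) n = qpoch a p n.
Proof.
move=> p0; elim: N => // N IH; rewrite ltnS leq_eqVlt => /predU1P[-> //|lt_nN].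
rewrite -(IH lt_nN); set P := (\prod_(j < N) _).
have -> : \prod_(j < N.+1) (1 - a * p ^+ j) = P - P * a * p ^+ N.
  by rewrite big_ord_recr /= mulrBr mulr1 mulrA.
rewrite -[LHS]/(P n - (P * a * p ^+ N) n).
rewrite coef_fpsM big1 ?subr0 // => i _.
by rewrite (coef_fpsX_exp p0) ?mulr0 // (leq_ltn_trans _ lt_nN) // leq_subr.
Qed.

(* \sum_(s in P) q^|s| w(s), over the partitions s satisfying P *)
Definition partition_series (P : pred (seq nat)) (w : seq nat -> A) : fps A :=
  FPS (fun n => \sum_(s <- partitions n | P s) w s).

End FpsRing.

Arguments fpsX {A}.

(* f(u) = \sum_k f_k u^k, for u with zero constant term: u^k = O(q^k), so the
   terms with k > n do not contribute to the coefficient of q^n. *)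
Definition fps_subst (R : comNzRingType) (f : fps R) (u : fps {poly R}) :
    fps {poly R} :=
  FPS (fun n => \sum_(k < n.+1) f k *: (u ^+ k) n).

Lemma fps_substE (R : comNzRingType) (f : fps R) (u : fps {poly R}) n N :
  u 0%N = 0 -> (n < N)%N ->
  \sum_(k < N) f k *: (u ^+ k) n = fps_subst f u n.
Proof.
move=> u0; elim: N => // N IH; rewrite ltnS leq_eqVlt => /predU1P[-> //|lt_nN].
by rewrite big_ord_recr /= (coef_fpsX_exp u0) // scaler0 addr0 IH.
Qed.

Definition f_series (R : comNzRingType) (t : nat) (rho1 : nat -> R) : fps R :=
  partition_series predT
    (fun s => \prod_(h <- hooks s) rho1 (t * h)%N ^+ 2).

Definition g_series (R : comNzRingType) (t : nat) (rho1 rho2 : nat -> R) :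
    fps R :=
  partition_series predT
    (fun s => (\prod_(h <- hooks s) rho1 (t * h)%N ^+ 2) *
              (\sum_(h <- hooks s) rho2 (t * h)%N)).

(* The indeterminate x is 'X : {poly R}. *)
Definition BG_series (R : comNzRingType) (z t : nat) (rho1 rho2 : nat -> R) :
    fps {poly R} :=
  partition_series (BG z t)
    (fun s => ((\prod_(h <- hooks_mult t s) rho1 h) *
               (\sum_(h <- hooks_mult t s) rho2 h))
              *: 'X^(size (hooks_mult t s))).

(* Main.v *)
(* The boundary path of a partition is a 0/1 word, and its hooks are the pairs
   "bead before gap" of that word, the hook length being their distance.  Cutting
   the word of length 2 M t into its t residue classes (runners) turns hooks
   divisible by t into the hooks of the runners.  For lambda in BG_{z,t} the
   z last runners and, when t - z is odd, the middle one of the others are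
   trivial; the remaining ones form m = floor((t - z) / 2) pairs, each made of an
   arbitrary word and of its reversed complement.  Hence lambda is the same as
   m arbitrary words, each of which contributes its hooks twice, and a weight
   depending only on its charge (its number of gaps minus M).  Fixing the
   charge, a word is a partition in a box that exceeds any given degree as M
   grows, and the sum over charges is a theta series.  The Jacobi triple
   product comes from the same words: summing over all of them factors over
   positions, whereas summing at fixed charge gives a q-binomial coefficient. *)

Require Import Defs.
From mathcomp Require Import all_boot all_algebra.
From mathcomp Require Import zify ring.

Set Implicit Arguments.
Unset Strict Implicit.
Unset Printing Implicit Defensive.

Import GRing.Theory.

(** * Sums over lists of fixed length *)

Fixpoint lists (T : Type) (X : seq T) (m : nat) : seq (seq T) :=
  if m is m'.+1 then [seq x :: l | x <- X, l <- lists X m'] else [:: [::]].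

Lemma mem_lists (T : eqType) (X : seq T) m l :
  (l \in lists X m) = (size l == m) && all [in X] l.
Proof.
elim: m l => [|m IH] [|x l] //=; first by apply/allpairsP => -[[]] ? ? [].
rewrite eqSS; apply/allpairsP/idP => [[[y k]] /= [yX]|/and3P[sl xX lX]].
  by rewrite IH => /andP[sk kX] [-> ->]; rewrite sk yX.
by exists (x, l); split=> //=; rewrite IH sl.
Qed.

Lemma lists_uniq (T : eqType) (X : seq T) m : uniq X -> uniq (lists X m).
Proof.
move=> uX; elim: m => //= m IH; apply: allpairs_uniq => //.
by move=> [x l] [y k] _ _ /= [-> ->].
Qed.

Lemma sum_lists_prod (A : comNzRingType) (T : Type) (x0 : T) (X : seq T) m
    (F : nat -> T -> A) :
  (\sum_(l <- lists X m) \prod_(i < m) F i (nth x0 l i) =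
   \prod_(i < m) \sum_(x <- X) F i x)%R.
Proof.
elim: m F => [|m IH] F /=; first by rewrite big_seq1 !big_ord0.
rewrite big_allpairs_dep big_ord_recl /= big_distrl /=; apply: eq_bigr => x _.
rewrite -(IH (fun i => F i.+1)) big_distrr /=; apply: eq_bigr => l _.
by rewrite big_ord_recl.
Qed.

(** Exchanging the sums singles out one index [j]; its [D] is absorbed into the [j]-th factor and
    distributivity applies. This produces one g-series next to a power of the f-series. *)
Lemma sum_lists_prod_sum (A : comNzRingType) (T : Type) (x0 : T) (X : seq T) m
    (F : nat -> T -> A) (D : T -> A) :
  (\sum_(l <- lists X m)
     (\prod_(i < m) F i (nth x0 l i)) * (\sum_(i < m) D (nth x0 l i)) =
   \sum_(j < m) (\sum_(x <- X) F j x * D x) *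
                \prod_(i < m | i != j) \sum_(x <- X) F i x)%R.
Proof.
under eq_bigr do rewrite big_distrr /=.
rewrite exchange_big /=; apply: eq_bigr => j _.
pose H (i : nat) x := (if i == j then F i x * D x else F i x)%R.
transitivity (\prod_(i < m) \sum_(x <- X) H i x)%R; last first.
  rewrite (bigD1 j) //=; congr (_ * _)%R.
    by apply: eq_bigr => x _; rewrite /H eqxx.
  apply: eq_bigr => i /negPf ij; apply: eq_bigr => x _.
  by rewrite /H (inj_eq val_inj) ij.
rewrite -(sum_lists_prod x0); apply: eq_bigr => l _.
rewrite [RHS](bigD1 j) //= /H eqxx mulrAC; congr (_ * _)%R.
rewrite (bigD1 j) //=; congr (_ * _)%R; apply: eq_bigr => i /negPf ij.
by rewrite (inj_eq val_inj) ij.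
Qed.

(** * Words, partitions and hooks *)

Definition gaps (u : seq bool) : nat := count negb u.

Arguments gaps : simpl never.

Lemma gaps_cons b u : gaps (b :: u) = ~~ b + gaps u.
Proof. by []. Qed.

Definition words : nat -> seq (seq bool) := lists [:: true; false].

Lemma mem_words L u : (u \in words L) = (size u == L).
Proof. by rewrite mem_lists; case: eqP => //= _; apply/allP => -[]. Qed.

Lemma words_uniq L : uniq (words L).
Proof. exact: lists_uniq. Qed.

Lemma size_gaps u : size u = count id u + gaps u.
Proof. by rewrite -(count_predC id). Qed.

Definition gap_positions (u : seq bool) : seq nat :=
  [seq l <- iota 0 (size u) | ~~ nth true u l].

Lemma gap_positions_cons b u :
  gap_positions (b :: u) =
  (if b then [::] else [:: 0]) ++ [seq l.+1 | l <- gap_positions u].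
Proof.
rewrite /gap_positions /= (iotaDl 1 0) filter_map.
by case: b.
Qed.

Lemma size_gap_positions u : size (gap_positions u) = gaps u.
Proof.
elim: u => // b u IH; rewrite gap_positions_cons size_cat size_map IH.
by case: b.
Qed.

Lemma mem_gap_positions u l : (l \in gap_positions u) = ~~ nth true u l.
Proof.
rewrite mem_filter mem_iota add0n andbC /=; case: ltnP => //= le_l.
by rewrite nth_default.
Qed.

(* Words list the boundary path of a diagram from its highest position: [true]
   is a bead (a row), [false] a gap (a column), and a cell is a bead followed by
   a gap. *)
Fixpoint part (u : seq bool) : seq nat :=
  if u is b :: u' then
    if b && (0 < gaps u') then gaps u' :: part u' else part u'
  else [::].

(** The distances from each bead to the gaps after it, one for each cell of [part u]; they turn out
    to be its hook lengths. *)
Fixpoint invs (u : seq bool) : seq nat :=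
  if u is b :: u' then
    (if b then [seq l.+1 | l <- gap_positions u'] else [::]) ++ invs u'
  else [::].

Lemma part_head u : head 0 (part u) <= gaps u.
Proof.
elim: u => //= b u IH; case: ifP => /= _; first exact: leq_addl.
exact: leq_trans IH (leq_addl _ _).
Qed.

Lemma part_is_partition u : is_partition (part u).
Proof.
elim: u => //= b u IH; case: ifP => // /andP[_ g0].
by rewrite is_partition_cons g0 part_head.
Qed.

Lemma gaps0_part u : gaps u = 0 -> part u = [::].
Proof. by elim: u => // -[] u IH; rewrite gaps_cons //= add0n => g0; rewrite g0; apply: IH. Qed.

Lemma head_partition_ge s x : is_partition s -> x \in s -> x <= head 0 s.
Proof.
elim: s => // p s IH; rewrite is_partition_cons inE => /and3P[_ hp /IH{}IH].
by case/predU1P => [->//|/IH xh]; apply: leq_trans xh hp.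
Qed.

Lemma size_le_sumn s : is_partition s -> size s <= sumn s.
Proof.
elim: s => //= p s IH; rewrite is_partition_cons => /and3P[p0 _ /IH]; lia.
Qed.

Lemma head_le_sumn s : head 0 s <= sumn s.
Proof. by case: s => //= p s; rewrite leq_addr. Qed.

Lemma count_gt_head s j : is_partition s -> head 0 s <= j -> count (ltn j) s = 0.
Proof.
move=> ps hj; apply/eqP; rewrite -leqn0 leqNgt -has_count.
apply/hasPn => x /(head_partition_ge ps) xh /=.
by rewrite -leqNgt (leq_trans xh).
Qed.

(** The gap of column [j] is preceded by the [gaps u - j - 1] gaps of the columns to its right and
    by the beads of the rows longer than [j]. The first gap belongs to the rightmost column, hence
    [rev]. So a bead put in front of [u] sees the gaps at the hook lengths of a new top row. *)
Lemma gap_positions_part u :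
  [seq l.+1 | l <- gap_positions u] =
  rev [seq gaps u - j + count (ltn j) (part u) | j <- iota 0 (gaps u)].
Proof.
elim: u => // -[] u IH; rewrite gap_positions_cons gaps_cons; last first.
  rewrite add1n -[X in iota 0 X]addn1 iotaD [part _]/= [_ ++ _ in LHS]/=.
  rewrite add0n map_cat rev_cat /= subSnn.
  rewrite count_gt_head ?part_is_partition ?part_head //; congr (_ :: _).
  rewrite IH map_rev; congr rev.
  rewrite -map_comp; apply/eq_in_map => j; rewrite mem_iota add0n => /= jg.
  by rewrite subSn ?addSn // ltnW.
rewrite add0n cat0s IH map_rev; congr rev.
rewrite -map_comp; apply/eq_in_map => j; rewrite mem_iota add0n => /= jg.
by rewrite (leq_ltn_trans _ jg) //= jg addnS.
Qed.

Lemma count_col_diagram s j :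
  count (fun v => v.2 == j) (diagram s) = count (ltn j) s.
Proof.
rewrite /diagram; set f := nth 0 s.
have {2}-> : s = [seq f i | i <- iota 0 (size s)] by rewrite map_nth_iota0 // take_size.
rewrite count_map.
elim: (iota 0 (size s)) => //= i l IH; rewrite count_cat IH count_map /=; congr (_ + _).
rewrite (eq_count (a2 := pred1 j)) // count_uniq_mem ?iota_uniq // mem_iota add0n.
by [].
Qed.

Lemma diagram_cons p s :
  diagram (p :: s) =
  [seq (0, j) | j <- iota 0 p] ++ [seq (v.1.+1, v.2) | v <- diagram s].
Proof.
rewrite /diagram /= (iotaDl 1 0); congr (_ ++ _).
rewrite map_flatten -!map_comp; congr flatten.
by apply: eq_map => i /=; rewrite -map_comp.
Qed.

Lemma size_diagram s : size (diagram s) = sumn s.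
Proof.
elim: s => // p s IH.
by rewrite diagram_cons size_cat !size_map size_iota IH.
Qed.

Lemma hooks_cons p s :
  hooks (p :: s) =
  [seq p - j + count (ltn j) s | j <- iota 0 p] ++ hooks s.
Proof.
rewrite /hooks diagram_cons map_cat; congr (_ ++ _); last first.
  rewrite -map_comp; apply: eq_map => -[i j].
  rewrite /hook_length diagram_cons /= !count_cat !count_map /=.
  rewrite [count _ (iota 0 p)](_ : _ = 0) ?[X in _ + (X + _)](_ : _ = 0) //.
    by rewrite (eq_count (a2 := pred0)) ?count_pred0 // => k; rewrite /= ltn0 andbF.
  by rewrite (eq_count (a2 := pred0)) ?count_pred0.
rewrite -map_comp; apply/eq_in_map => j; rewrite mem_iota add0n => /= jp.
rewrite /hook_length diagram_cons /= !count_cat !count_map /=.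
rewrite -(count_col_diagram s).
rewrite [X in _ + X + _ = _]addnC.
rewrite [count _ (diagram s)](_ : _ = 0); last first.
  by rewrite (eq_count (a2 := pred0)) ?count_pred0.
rewrite [X in _ + (X + _)](_ : _ = 0); last first.
  by rewrite (eq_count (a2 := pred0)) ?count_pred0 // => k; rewrite /= andbF.
rewrite !add0n; congr (_ + _); last by apply: eq_count => v; rewrite /= andbT.
rewrite (eq_count (a2 := ltn j)); last by move=> k /=.
rewrite -(subnKC jp) iotaD count_cat add0n.
rewrite [X in 1 + (X + _)](_ : _ = 0); last first.
  by apply/eqP; rewrite -leqn0 leqNgt -has_count; apply/hasPn => x; rewrite mem_iota /=; lia.
rewrite [count _ _](_ : _ = p - j.+1); first by lia.
rewrite -[RHS](size_iota j.+1); apply/eqP; rewrite -all_count; apply/allP => x.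
by rewrite mem_iota /=; lia.
Qed.

(** A leading bead adds a top row whose hooks are its distances to the later gaps, and leaves the
    hooks below unchanged. With no gap after it, it adds neither a row nor a distance. *)
Lemma perm_hooks_part u : perm_eq (hooks (part u)) (invs u).
Proof.
elim: u => // -[] u IH //=; case: posnP => [g0|g0].
  rewrite (_ : gap_positions u = [::]) //; apply/nilP.
  by rewrite /nilp size_gap_positions g0.
by rewrite gap_positions_part hooks_cons perm_cat // perm_sym perm_rev.
Qed.

Lemma sumn_part u : sumn (part u) = size (invs u).
Proof. by rewrite -(perm_size (perm_hooks_part u)) size_map size_diagram. Qed.

Lemma part_bead_neq_gap u v :
  gaps u = (gaps v).+1 -> part (true :: u) <> part (false :: v).
Proof.
move=> guv /= E; have := part_head v.
by rewrite -E guv /= ltnn.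
Qed.

(** A leading bead makes the first row as long as the number of gaps, a leading gap makes it
    strictly shorter; so the partition determines the letters one by one. *)
Lemma part_inj u v :
  size u = size v -> gaps u = gaps v -> part u = part v -> u = v.
Proof.
elim: u v => [|b u IH] [|c v] // [suv]; case: b; case: c => // guv.
- have {}guv : gaps u = gaps v by [].
  rewrite /= guv; case: posnP => [g0|_ [puv]]; last by rewrite (IH v).
  by rewrite !gaps0_part ?guv // => _; rewrite (IH v) // !gaps0_part ?guv.
- by move/part_bead_neq_gap; case.
- by move/esym/part_bead_neq_gap; case.
- have {}guv : gaps u = gaps v by case: guv.
  by move=> /= puv; rewrite (IH v).
Qed.

(** The [B] by [G] box is peeled: a full first row becomes a bead, otherwise the empty last column
    becomes a gap. *)
Lemma part_surj s B G :
  is_partition s -> size s <= B -> head 0 s <= G ->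
  exists u, [/\ count id u = B, gaps u = G & part u = s].
Proof.
have [n] := ubnP (B + G); elim: n s B G => // n IH s B G le_n ps sB sG.
have [hs|hs] := eqVneq (head 0 s) G; last first.
  case: G sG hs le_n => [|G]; first by rewrite leqn0 => ->.
  rewrite leq_eqVlt ltnS => /orP[/eqP->|sG _]; first by rewrite eqxx.
  rewrite addnS !ltnS => le_n.
  have [//|//|//|//|u [bu gu <-]] := IH s B G.
  by exists (false :: u); rewrite gaps_cons /= bu gu.
case: B sB le_n => [|B].
  rewrite leqn0 => /nilP s0 _; rewrite s0 /= in hs *; rewrite -hs.
  by exists [::].
move=> sB le_n; rewrite addSn ltnS in le_n.
have pbs : is_partition (behead s).
  by case: (s) ps => //= p s'; rewrite is_partition_cons => /and3P[].
have sbs : size (behead s) <= B by rewrite size_behead; case: (size s) sB.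
have hbs : head 0 (behead s) <= G.
  by rewrite -hs; case: (s) ps => //= p s'; rewrite is_partition_cons => /and3P[].
have [//|//|//|//|u [bu gu pu]] := IH (behead s) B G.
exists (true :: u); split; rewrite ?gaps_cons /= ?bu ?gu //.
case: posnP => [G0|G0]; last by rewrite pu -hs; case: (s) hs G0 => //= <-.
move: pu; rewrite gaps0_part ?gu //; move: hs ps; case: (s) => //= p s'.
by rewrite is_partition_cons G0 => ->.
Qed.

(** Reversing the boundary path and exchanging rows with columns gives the path of the conjugate
    partition. *)
Definition cmpl (u : seq bool) : seq bool := rev (map negb u).

Lemma size_cmpl u : size (cmpl u) = size u.
Proof. by rewrite size_rev size_map. Qed.

Lemma gaps_cmpl u : gaps (cmpl u) = count id u.
Proof.
rewrite /gaps /cmpl count_rev count_map; apply: eq_count => b /=.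
exact: negbK.
Qed.

Lemma nth_cmpl u k : k < size u -> nth true (cmpl u) k = ~~ nth true u (size u - k.+1).
Proof.
move=> ku; rewrite nth_rev size_map // (nth_map true) //; lia.
Qed.

(** The default letter [true] continues the word by beads, so a position [k + h] past the end counts
    for nothing. *)
Lemma count_mem_invs u h :
  count_mem h (invs u) =
  if h == 0 then 0 else
  \sum_(0 <= k < size u) (nth true u k && ~~ nth true u (k + h)).
Proof.
elim: u => [|b u IH]; first by rewrite big_geq ?if_same.
rewrite [invs _]/= count_cat IH; case: h {IH} => [|h] /=.
  rewrite addn0; case: b => //; rewrite count_map; apply/eqP.
  by rewrite -leqn0 leqNgt -has_count; apply/hasPn => x.
rewrite big_nat_recl //=; congr (_ + _); case: b => //=.
rewrite count_map (eq_count (a2 := pred1 h)); last by move=> k /=; rewrite eqSS.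
by rewrite count_uniq_mem ?filter_uniq ?iota_uniq // mem_gap_positions.
Qed.

Lemma perm_invs_cmpl u : perm_eq (invs (cmpl u)) (invs u).
Proof.
apply/allP => h _ /=; apply/eqP; rewrite !count_mem_invs; case: eqP => // h0.
(* From [size u - h] on, the second position leaves the word; below, [k] is matched with
   [size u - h - k.+1]. *)
rewrite size_cmpl [LHS](big_cat_nat (n := size u - h)) ?leq_subr //=.
rewrite [RHS](big_cat_nat (n := size u - h)) ?leq_subr //=.
rewrite addnC [X in X + _ = _]big_nat_cond [X in X + _ = _]big1 ?add0n; last first.
  move=> k /andP[/andP[k1 k2] _]; rewrite (nth_default true (n := k + h)) ?andbF // size_cmpl; lia.
rewrite addnC [X in _ = X + _]big_nat_cond [X in _ = X + _]big1 ?add0n; last first.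
  move=> k /andP[/andP[k1 k2] _]; rewrite (nth_default true (n := k + h)) ?andbF //; lia.
rewrite big_nat_rev /= big_nat_cond [RHS]big_nat_cond; apply: eq_bigr => k /andP[/andP[_ kh] _].
rewrite add0n !nth_cmpl ?negbK; [|lia..].
rewrite andbC; congr (nat_of_bool (nth _ _ _ && ~~ nth _ _ _)); lia.
Qed.

(** * Frobenius coordinates *)

(** The bead of row [i] has [i] beads and [gaps u - nth 0 (part u) i] gaps before it. Beads followed
    by no gap are the rows of length 0 supplied by the default of [nth]. *)
Lemma bead_part u k :
  (k < size u) && nth true u k <->
  exists2 i, i < count id u & k + nth 0 (part u) i = gaps u + i.
Proof.
elim: u k => [|b u IH] k; first by split=> [|[]//]; rewrite ltn0.
have hd i : nth 0 (part u) i <= gaps u.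
  apply: leq_trans (part_head u); case: (ltnP i (size (part u))) => si.
    by apply: head_partition_ge; [exact: part_is_partition|exact: mem_nth].
  by rewrite nth_default.
rewrite gaps_cons; case: b; rewrite /= ?add0n ?add1n ?addn0.
  have E i : nth 0 (if 0 < gaps u then gaps u :: part u else part u) i =
             if i is i'.+1 then nth 0 (part u) i' else gaps u.
    case: posnP => [g0|_]; last by case: i.
    by rewrite gaps0_part // g0; case: i => [|[|i]].
  case: k => [|k]; first by split=> // _; exists 0; rewrite ?E ?addn0.
  rewrite ltnS; split=> [/IH[i ib ki]|[[|i] ib]].
    by exists i.+1; rewrite ?E; lia.
    by rewrite E; lia.
  by rewrite E => ki; apply/IH; exists i => //; lia.
case: k => [|k] /=.
  by split=> // -[i ib]; have := hd i; lia.
rewrite ltnS; split=> [/IH[i ib ki]|[i ib ki]]; first by exists i => //; lia.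
by apply/IH; exists i => //; lia.
Qed.

Lemma gap_part u k :
  ~~ nth true u k <->
  exists2 j, j < gaps u & k.+1 + j = gaps u + count (ltn j) (part u).
Proof.
rewrite -mem_gap_positions -(mem_map succn_inj) gap_positions_part mem_rev.
split=> [/mapP[j]|[j jg E]].
  by rewrite mem_iota add0n => /= jg ->; exists j => //; lia.
by apply/mapP; exists j; rewrite ?mem_iota //; lia.
Qed.

(** Both sides say that the cell [(i, j)] lies in the diagram, read by column and by row. *)
Lemma count_gt_nth s i j : is_partition s -> (i < count (ltn j) s) = (j < nth 0 s i).
Proof.
elim: s i => [|p s IH] i; first by rewrite nth_nil.
rewrite is_partition_cons => /and3P[_ hp ps] /=.
case: (ltnP j p) => jp; first by case: i => [|i]; rewrite add1n ?ltnS ?IH.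
rewrite count_gt_head ?(leq_trans hp) // ltn0; apply/esym/negbTE; rewrite -leqNgt.
case: i => [|i]; rewrite ?jp //=; apply: leq_trans jp; apply: leq_trans hp.
case: (ltnP i (size s)) => si; last by rewrite nth_default.
by apply: head_partition_ge => //; exact: mem_nth.
Qed.

Lemma nth_partition_le s i j : is_partition s -> i <= j -> nth 0 s j <= nth 0 s i.
Proof.
move=> ps ij; case: (posnP (nth 0 s j)) => [->//|sj].
rewrite -[nth 0 s j]prednK // -count_gt_nth //; apply: leq_ltn_trans ij _.
by rewrite count_gt_nth // prednK.
Qed.

Lemma nth_conjugate s i : is_partition s -> nth 0 (conjugate s) i = count (ltn i) s.
Proof.
move=> ps; rewrite /conjugate; case: (ltnP i (head 0 s)) => hi.
  by rewrite (nth_map 0) ?size_iota // nth_iota.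
by rewrite nth_default ?size_map ?size_iota // count_gt_head.
Qed.

Lemma lt_durfee s i : is_partition s -> (i < durfee s) = (i < nth 0 s i).
Proof.
move=> ps; apply/idP/idP => [|si].
  rewrite /durfee; pose P (d : 'I_(size s).+1) := all (leq d) (take d s).
  have [|d Pd ->] := @eq_bigmax_cond _ P (fun d => d : nat).
    by apply/card_gt0P; exists ord0; rewrite unfold_in /P /= take0.
  move: Pd; rewrite unfold_in => /allP Pd i_d.
  apply: (leq_trans (i_d)); apply: Pd; rewrite -(nth_take 0 i_d) mem_nth // size_takel //.
  by rewrite -ltnS.
have ss : i < size s.
  by case: (ltnP i (size s)) => // h; rewrite nth_default in si.
have io : i.+1 < (size s).+1 by [].
apply: (leq_bigmax_cond (Ordinal io)); apply/(all_nthP 0) => k.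
rewrite size_takel // => ki; rewrite nth_take //.
by apply: leq_trans si _; apply: nth_partition_le.
Qed.

Section Frobenius.
Variables (u : seq bool) (N : nat).
Hypotheses (Bu : count id u = N) (Gu : gaps u = N).
Let s := part u.
Let ps : is_partition s := part_is_partition u.

Lemma nth_part_le i : nth 0 s i <= N.
Proof.
rewrite -Gu; apply: leq_trans (part_head u).
by rewrite -nth0; apply: nth_partition_le.
Qed.

(** With [N] beads and [N] gaps, the main diagonal meets the boundary path at the middle of the
    word. The upper coordinates are read off the beads of the first half, backwards from the middle,
    and the lower ones off the gaps of the second half. *)
Lemma mem_frobenius_alpha x :
  (x \in frobenius_alpha s) = (x < N) && nth true u (N - x.+1).
Proof.
have su : size u = N + N by rewrite size_gaps Bu Gu.
apply/mapP/andP => [[i]|[xN]].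
  rewrite mem_iota add0n => /=; rewrite lt_durfee // => is_ ->.
  have sN := nth_part_le i; split; first by lia.
  have /andP[] // : (N - (nth 0 s i - i.+1).+1 < size u) &&
            nth true u (N - (nth 0 s i - i.+1).+1).
  apply/bead_part; exists i; first by rewrite Bu; lia.
  by rewrite Gu -/s; lia.
move=> bx; have /bead_part[i iN] : (N - x.+1 < size u) && nth true u (N - x.+1).
  by rewrite bx su; lia.
rewrite Gu -/s => E; exists i; last by lia.
by rewrite mem_iota /= lt_durfee //; lia.
Qed.

Lemma mem_frobenius_beta x : (x \in frobenius_beta s) = ~~ nth true u (N + x).
Proof.
apply/mapP/idP => [[i]|].
  rewrite mem_iota add0n => /=; rewrite lt_durfee // => is_.
  rewrite nth_conjugate // => ->.
  have ci : i < count (ltn i) s by rewrite count_gt_nth.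
  have sN := nth_part_le i.
  by apply/gap_part; exists i; rewrite Gu -/s; lia.
case/gap_part => j; rewrite Gu -/s => jN E; exists j.
  by rewrite mem_iota /= lt_durfee // -count_gt_nth //; lia.
by rewrite nth_conjugate //; lia.
Qed.

Lemma frobenius_alpha_sorted : sorted gtn (frobenius_alpha s).
Proof.
apply: (@homo_sorted_in _ _ (fun i => i < durfee s) _ ltn); last 2 first.
- by apply/allP => i; rewrite mem_iota.
- exact: iota_ltn_sorted.
move=> i j; rewrite !unfold_in !lt_durfee // => hi hj ij.
by have := nth_partition_le ps (ltnW ij); rewrite /=; lia.
Qed.

Lemma frobenius_beta_sorted : sorted gtn (frobenius_beta s).
Proof.
apply: (@homo_sorted_in _ _ (fun i => i < durfee s) _ ltn); last 2 first.
- by apply/allP => i; rewrite mem_iota.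
- exact: iota_ltn_sorted.
move=> i j; rewrite !unfold_in !lt_durfee // -!count_gt_nth // => hi hj ij /=.
rewrite !nth_conjugate //.
have : count (ltn j) s <= count (ltn i) s.
  by apply: sub_count => p /=; apply: ltn_trans.
by move: ij; lia.
Qed.

(** The reflection from [N - x.+1] to [N + (x - z)] pairs the two rows of coordinates. The second
    clause excludes a lower coordinate [y] whose partner [y + z] would fall outside the first
    half. *)
Lemma asymmetricP z :
  reflect ((forall x, x < N ->
              nth true u (N - x.+1) = (z <= x) && ~~ nth true u (N + (x - z))) /\
           (forall y, N - z <= y < N -> nth true u (N + y)))
          (asymmetric z s).
Proof.
have su : size u = N + N by rewrite size_gaps Bu Gu.
have memz x : (x \in [seq a + z | a <- frobenius_beta s]) =
              (z <= x) && ~~ nth true u (N + (x - z)).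
  apply/mapP/andP => [[y]|[zx]].
    by rewrite mem_frobenius_beta => yb ->; rewrite addnK leq_addl.
  by rewrite -mem_frobenius_beta => xb; exists (x - z); rewrite ?subnK.
apply: (iffP eqP) => [E|[H1 H2]].
  have {}memz x : (x < N) && nth true u (N - x.+1) =
                 (z <= x) && ~~ nth true u (N + (x - z)).
    by rewrite -memz -E mem_frobenius_alpha.
  split=> [x xN|y /andP[y1 y2]]; first by rewrite -memz xN.
  apply/negPn/negP => yb; have := memz (y + z).
  by rewrite addnK yb leq_addl andbT ltnNge; lia.
(* Both lists are strictly decreasing, so having the same members suffices. *)
apply: (@irr_sorted_eq _ gtn).
- by move=> a b c /= ab bc; apply: ltn_trans ab.
- exact: ltnn.
- exact: frobenius_alpha_sorted.
- rewrite sorted_map; apply: sub_sorted frobenius_beta_sorted => a b /=.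
  by rewrite ltn_add2r.
move=> x; rewrite mem_frobenius_alpha memz; case: ltnP => xN /=; first by rewrite H1.
apply/esym/negbTE/nandP; case: leqP => zx; [right|by left]; rewrite negbK.
case: (ltnP (x - z) N) => xzN; first by apply: H2; lia.
by rewrite nth_default // su leq_add2l.
Qed.

End Frobenius.

(** The reflection of a z-asymmetric word sends position [p] to [2 * N - z - 1 - p], hence residue
    [r < t - z] to [t - z - r - 1]. The two divisibility conditions forbid gaps in the second half
    on the last [z] residues and on the residue fixed by the reflection; there all gaps come
    first. *)
Lemma BG_wordP u M t z :
  1 < t -> z < t -> count id u = M * t -> gaps u = M * t ->
  reflect (forall a r, a < 2 * M -> r < t ->
             nth true u (a * t + r) =
             if (r < t - z) && (2 * r + z + 1 != t)
             then ~~ nth true u ((2 * M - a.+1) * t + (t - z - r.+1))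
             else M <= a)
          (BG z t (part u)).
Proof.
move=> t1 zt; set N := M * t => Bu Gu.
have su : size u = N + N by rewrite size_gaps Bu Gu.
apply: (iffP andP) => [[/(asymmetricP Bu Gu)[H1 H2] /allP H3] a r a2M rt|H].
  have H3a y k : 0 < k <= z -> t %| y + k -> nth true u (N + y).
    move=> kz tk; apply/negPn/negP; rewrite -(mem_frobenius_beta Bu Gu) => /H3/andP[/allP/(_ k)].
    by rewrite mem_iota tk => /(_ ltac:(lia)).
  have H3b y b : 2 * y + z + 1 = (b.*2.+1) * t -> nth true u (N + y).
    move=> E; apply/negPn/negP; rewrite -(mem_frobenius_beta Bu Gu) => /H3/andP[_].
    by rewrite E dvdn_mull // mulnK ?(ltnW t1) //= odd_double.
  case: (leqP M a) => aM.
    have EN : a * t + r = N + ((a - M) * t + r) by rewrite /N; nia.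
    case: ifP => [/andP[rz _]|/negbT].
      have := H1 ((a - M) * t + r + z); rewrite addnK leq_addl -EN /=.
      have -> : N - ((a - M) * t + r + z).+1 = (2 * M - a.+1) * t + (t - z - r.+1).
        rewrite /N; nia.
      move=> ->; rewrite ?negbK //.
      have : (a - M).+1 * t <= N by rewrite leq_mul2r; lia.
      by nia.
    rewrite negb_and -leqNgt negbK EN => /orP[rz|/eqP rt2].
      apply: (H3a _ (t - r)); first by lia.
      by rewrite -addnA subnKC ?dvdn_addr ?dvdn_mull // ltnW.
    by apply: (H3b _ (a - M)); rewrite -addnn; nia.
  have EN : N - (N - (a * t + r).+1).+1 = a * t + r.
    have : a.+1 * t <= N by rewrite leq_mul2r; lia.
    by nia.
  have Ex : N - (a * t + r).+1 = (M - a.+1) * t + (t - r.+1) by rewrite /N; nia.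
  have := H1 (N - (a * t + r).+1); rewrite EN => ->; last first.
    have : a.+1 * t <= N by rewrite leq_mul2r; lia.
    by nia.
  rewrite Ex; case: ifP => [/andP[rz _]|/negbT].
    have -> : z <= (M - a.+1) * t + (t - r.+1) by nia.
    congr (~~ nth _ _ _); rewrite /N; nia.
  rewrite negb_and -leqNgt negbK => /orP[rz|/eqP rt2].
    apply/negbTE/nandP; case: leqP => zx; [right|by left]; rewrite negbK.
    apply: (H3a _ (z - (t - r.+1))); first by lia.
    rewrite (_ : _ + _ = (M - a.+1) * t) ?dvdn_mull //; lia.
  apply/negbTE/nandP; right; rewrite negbK.
  by apply: (H3b _ (M - a.+1)); rewrite -addnn; nia.
have t0 : 0 < t by lia.
have modN x : x < N -> exists a r, [/\ a < M, r < t & x = a * t + r].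
  move=> xN; exists (x %/ t), (x %% t); rewrite -divn_eq ltn_mod t0; split=> //.
  by rewrite ltn_divLR.
split.
  apply/(asymmetricP Bu Gu); split=> [x xN|y /andP[y1 y2]].
    have [|a [r [aM rt E]]] := modN (N - x.+1); first by lia.
    have Ex : x = (M - a.+1) * t + (t - r.+1) by rewrite /N in xN E; nia.
    rewrite E H //; last by lia.
    case: ifP => [/andP[rz _]|/negbT].
      have -> : z <= x by lia.
      congr (~~ nth _ _ _); rewrite Ex /N; nia.
    rewrite negb_and -leqNgt negbK => /orP[rz|/eqP rt2].
      rewrite leqNgt aM /=; apply/esym/negbTE/nandP.
      case: leqP => zx; [right|by left]; rewrite negbK.
      have aM2 : a.+1 < M.
        by rewrite ltnNge; apply/negP => aM2; have := zx; rewrite Ex (_ : M - a.+1 = 0); lia.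
      (* The reflection permutes the last [z] residues among themselves, but with a borrow of one
         block, hence [a.+2]. *)
      have -> : N + (x - z) = (2 * M - a.+2) * t + (2 * t - r.+1 - z) by rewrite Ex /N; nia.
      rewrite H; [|lia..]; rewrite (_ : _ < t - z = false) /=; lia.
    rewrite leqNgt aM /=; apply/esym/negbTE/nandP; right; rewrite negbK.
    have -> : N + (x - z) = (2 * M - a.+1) * t + r by rewrite Ex /N; nia.
    rewrite H; [|lia..]; rewrite rt2 eqxx andbF; lia.
  have -> : N + y = (2 * M - 1) * t + (y - (M - 1) * t).
    rewrite /N in y1 y2 *; nia.
  have M0 : 0 < M by case: (M) @N y2 {Bu Gu su y1 modN H} => //; lia.
  have EN : N = (M - 1) * t + t by rewrite /N; nia.
  rewrite H; [|lia..].
  rewrite (_ : _ < t - z = false) /=; lia.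
apply/allP => y; rewrite (mem_frobenius_beta Bu Gu) => yb.
have yN : y < N.
  by rewrite ltnNge; apply/negP => Ny; rewrite nth_default // su leq_add2l in yb.
have [a [r [aM rt E]]] := modN _ yN.
have EN : N + y = (M + a) * t + r by rewrite E /N; nia.
move: yb; rewrite EN H; [|lia..].
case: ifP => [/andP[rz rt2] _|_]; last by rewrite leq_addr.
apply/andP; split.
  apply/allP => k; rewrite mem_iota => k1; rewrite E -addnA dvdn_addr ?dvdn_mull //.
  by rewrite gtnNdvd //; lia.
(* Since [r < t - z], the number [2 * r + z + 1] lies strictly between 0 and [2 * t]; the only
   candidate multiple is [t], excluded by [rt2]. *)
apply/nandP; left; have -> : 2 * y + z + 1 = (2 * a) * t + (2 * r + z + 1) by lia.
rewrite dvdn_addr ?dvdn_mull //; apply/negP => /dvdnP[c Ec].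
case: c Ec => [|[|c]] Ec; [lia| |nia].
by rewrite Ec mul1n eqxx in rt2.
Qed.

(** * Runners *)

Lemma big_nat_residues (R : Type) (idx : R) (op : Monoid.com_law idx) L t
    (F : nat -> R) :
  \big[op/idx]_(0 <= k < L * t) F k =
  \big[op/idx]_(0 <= r < t) \big[op/idx]_(0 <= a < L) F (a * t + r).
Proof.
rewrite big_nat_mul exchange_big /=; apply: eq_bigr => a _.
rewrite (big_addn 0 _ (a * t)) mulSn addnK; apply: eq_bigr => r _.
by rewrite addnC.
Qed.

(** The abacus: it interleaves [t] runners of length [L], undoing the cutting of a word into residue
    classes modulo [t]. *)
Definition weave (t L : nat) (rs : seq (seq bool)) : seq bool :=
  mkseq (fun k => nth true (nth [::] rs (k %% t)) (k %/ t)) (L * t).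

Section Weave.
Variables (t L : nat) (rs : seq (seq bool)).
Hypotheses (t_gt0 : 0 < t) (size_rs : size rs = t).
Hypothesis size_runner : all (fun v => size v == L) rs.

Lemma size_weave : size (weave t L rs) = L * t.
Proof. exact: size_mkseq. Qed.

Lemma size_nth_runner r : r < t -> size (nth [::] rs r) = L.
Proof. by move=> rt; apply/eqP/(all_nthP [::] size_runner); rewrite size_rs. Qed.

Lemma nth_weave a r : r < t ->
  nth true (weave t L rs) (a * t + r) = nth true (nth [::] rs r) a.
Proof.
move=> rt; have at_ : (a * t + r < L * t) = (a < L) by nia.
case: (ltnP a L) => aL; last first.
  have sa : size (weave t L rs) <= a * t + r by rewrite size_weave leqNgt at_ -leqNgt.
  by rewrite (nth_default _ sa) nth_default // size_nth_runner.
rewrite nth_mkseq ?at_ //.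
by rewrite modnMDl modn_small // divnMDl // divn_small // addn0.
Qed.

Lemma big_runners (R : Type) (idx : R) (op : Monoid.com_law idx) (F : seq bool -> R) :
  \big[op/idx]_(v <- rs) F v = \big[op/idx]_(0 <= r < t) F (nth [::] rs r).
Proof. by rewrite (big_nth [::]) size_rs. Qed.

Lemma gaps_nth u : gaps u = \sum_(0 <= k < size u) ~~ nth true u k.
Proof.
by rewrite -(big_nth true xpredT (fun b => ~~ b : nat)) /gaps -sum1_count big_mkcond.
Qed.

Lemma gaps_weave : gaps (weave t L rs) = \sum_(v <- rs) gaps v.
Proof.
rewrite gaps_nth size_weave big_nat_residues big_runners.
apply: eq_big_nat => r /andP[_ rt]; rewrite gaps_nth size_nth_runner //.
by apply: eq_bigr => a _; rewrite nth_weave.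
Qed.

(** Letters at distance [h * t] lie on one runner, at distance [h] there; multiplicities are
    compared residue by residue. *)
Lemma perm_invs_weave :
  perm_eq [seq h <- invs (weave t L rs) | t %| h]
          [seq t * h | h <- flatten [seq invs v | v <- rs]].
Proof.
apply/allP => x _ /=; apply/eqP.
rewrite count_filter.
have [/dvdnP[h ->]|tx] := boolP (t %| x); last first.
  rewrite (eq_count (a2 := pred0)) ?count_pred0.
    rewrite count_map (eq_count (a2 := pred0)) ?count_pred0 // => h /=.
    by apply/negP => /eqP xE; rewrite -xE dvdn_mulr in tx.
  by move=> y /=; apply/negP => /andP[/eqP-> tx2]; rewrite tx2 in tx.
rewrite (eq_count (a2 := pred1 (h * t))); last first.
  by move=> y /=; case: eqP => //= ->; rewrite dvdn_mull.
rewrite count_map (eq_count (a1 := preim _ _) (a2 := pred1 h)); last first.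
  by move=> y /=; rewrite mulnC eqn_pmul2r.
rewrite count_flatten -map_comp sumnE big_map big_runners.
rewrite count_mem_invs muln_eq0 (gtn_eqF t_gt0) orbF; case: (posnP h) => h0.
  rewrite big1 // => r _; by rewrite /= count_mem_invs h0.
rewrite size_weave big_nat_residues.
apply: eq_big_nat => r /andP[_ rt]; rewrite /= count_mem_invs gtn_eqF //.
rewrite size_nth_runner //; apply: eq_bigr => a _.
by rewrite addnAC -mulnDl !nth_weave.
Qed.

(** Unlike the number of bead-gap pairs, the sum of the gap positions is computed runner by runner;
    [gap_sumE] then recovers the weight of the partition. *)
Definition gap_sum (u : seq bool) : nat := \sum_(0 <= k < size u) ~~ nth true u k * k.

Lemma gap_sum_weave :
  gap_sum (weave t L rs) =
  \sum_(0 <= r < t) (t * gap_sum (nth [::] rs r) + r * gaps (nth [::] rs r)).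
Proof.
rewrite /gap_sum size_weave big_nat_residues.
apply: eq_big_nat => r /andP[_ rt]; rewrite gaps_nth size_nth_runner //.
rewrite !big_distrr -big_split /=; apply: eq_bigr => a _.
by rewrite nth_weave // mulnDr; lia.
Qed.

End Weave.

(** The position of a gap counts the letters before it: the beads give the pairs, the gaps give the
    binomial coefficient. *)
Lemma gap_sumE u : gap_sum u = size (invs u) + 'C(gaps u, 2).
Proof.
have E b v : gap_sum (b :: v) = gap_sum v + gaps v.
  rewrite /gap_sum big_nat_recl //= muln0 add0n gaps_nth -big_split /=.
  by apply: eq_bigr => k _; rewrite mulnS addnC.
elim: u => [|b u IH]; first by rewrite /gap_sum big_geq.
rewrite E IH /= size_cat gaps_cons; case: b => /=.
  by rewrite size_map size_gap_positions add0n; lia.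
by rewrite add1n binS bin1; lia.
Qed.

(** * The runners of partitions in BG *)

Definition triv (M : nat) : seq bool := nseq M false ++ nseq M true.

Lemma size_triv M : size (triv M) = 2 * M.
Proof. by rewrite size_cat !size_nseq; lia. Qed.

Lemma gaps_triv M : gaps (triv M) = M.
Proof. by rewrite /gaps count_cat !count_nseq /= mul1n mul0n addn0. Qed.

Lemma nth_triv M a : nth true (triv M) a = (M <= a).
Proof.
rewrite nth_cat size_nseq; case: ltnP => aM; first by rewrite nth_nseq aM.
by rewrite nth_nseq if_same.
Qed.

Lemma invs_triv M : invs (triv M) = [::].
Proof.
rewrite /triv; elim: (X in nseq X false) => [|k IH] //=.
elim: M => //= M IH; rewrite IH cats0 (_ : gap_positions _ = [::]) //.
by apply/nilP; rewrite /nilp size_gap_positions /gaps count_nseq.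
Qed.

(** [rev] makes runners [r] and [t - z - r - 1] reversed complements of each other; the middle block
    holds 0 or 1 runner by the parity of [t - z]. *)
Definition runners (t z M : nat) (vs : seq (seq bool)) : seq (seq bool) :=
  let m := (t - z) %/ 2 in
  (vs ++ nseq (t - z - 2 * m) (triv M) ++ rev (map cmpl vs)) ++ nseq z (triv M).

Section Runners.
Variables (t z M : nat).
Hypotheses (t_gt1 : 1 < t) (z_lt : z < t).
Let m := (t - z) %/ 2.
Let m_le : 2 * m <= t - z.
Proof. by rewrite mulnC leq_divM. Qed.
Let m_lt : t - z < 2 * m + 2.
Proof. by rewrite -mulnSr mulnC -ltn_divLR. Qed.

Variable vs : seq (seq bool).
Hypotheses (size_vs : size vs = m) (sizes_vs : all (fun v => size v == 2 * M) vs).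
Let rs := runners t z M vs.

Lemma size_runners : size rs = t.
Proof. by rewrite /rs /runners !size_cat !size_nseq size_rev size_map size_vs -/m; lia. Qed.

Lemma sizes_runners : all (fun v => size v == 2 * M) rs.
Proof.
rewrite /rs /runners !all_cat all_rev !all_nseq size_triv eqxx !orbT sizes_vs !andbT /=.
by rewrite all_map; apply: sub_all sizes_vs => v /=; rewrite size_cmpl.
Qed.

Lemma nth_runners r : r < t ->
  nth [::] rs r =
  if r < m then nth [::] vs r
  else if (r < t - z) && (t - z - r.+1 < m) then cmpl (nth [::] vs (t - z - r.+1))
  else triv M.
Proof.
move=> rt; rewrite /rs /runners -/m nth_cat !size_cat size_nseq size_rev size_map size_vs.
rewrite (_ : m + _ = t - z); last by lia.
case: (ltnP r (t - z)) => rz; last first.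
  rewrite nth_nseq ifT; last by lia.
  by rewrite ifF //; lia.
rewrite nth_cat size_vs; case: ltnP => rm //.
rewrite nth_cat size_nseq nth_nseq; case: ltnP => rm2.
  by rewrite ifF //=; lia.
rewrite nth_rev size_map size_vs; last by lia.
rewrite ifT /=; last by lia.
rewrite (nth_map [::]); last by lia.
congr (cmpl (nth _ _ _)); lia.
Qed.

Lemma size_nth_vs r : r < m -> size (nth [::] vs r) = 2 * M.
Proof. by move=> rm; apply/eqP/(all_nthP [::] sizes_vs); rewrite size_vs. Qed.

Lemma sum_pairs (F : nat -> nat) :
  \sum_(0 <= r < t) F r =
  \sum_(r < m) (F r + F (t - z - r.+1)) +
  \sum_(m <= r < t - z - m) F r + \sum_(t - z <= r < t) F r.
Proof.
rewrite (big_cat_nat (n := t - z)) ?leq_subr //=; congr (_ + _).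
rewrite (big_cat_nat (n := m)) //=; last by lia.
rewrite (big_cat_nat (m := m) (n := t - z - m)) ?leq_subr //=; last by lia.
rewrite addnA [in LHS]addnAC; congr (_ + _); rewrite big_split /= big_mkord; congr (_ + _).
by rewrite big_rev_mkord subKn //; lia.
Qed.

(** Only the [m] pairs differ from the all-trivial configuration. Trivial terms stand on both sides
    to avoid truncated subtraction. *)
Lemma sum_runners (H : nat -> seq bool -> nat) :
  \sum_(0 <= r < t) H r (nth [::] rs r) +
  \sum_(r < m) (H r (triv M) + H (t - z - r.+1) (triv M)) =
  \sum_(0 <= r < t) H r (triv M) +
  \sum_(r < m) (H r (nth [::] vs r) + H (t - z - r.+1) (cmpl (nth [::] vs r))).
Proof.
rewrite !sum_pairs.
rewrite (_ : \sum_(m <= r < t - z - m) H r (nth [::] rs r) =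
             \sum_(m <= r < t - z - m) H r (triv M)); last first.
  by apply: eq_big_nat => r rm; rewrite nth_runners ?ifF //; lia.
rewrite (_ : \sum_(t - z <= r < t) H r (nth [::] rs r) =
             \sum_(t - z <= r < t) H r (triv M)); last first.
  by apply: eq_big_nat => r rm; rewrite nth_runners ?ifF //; lia.
rewrite (_ : \sum_(r < m) (H r (nth [::] rs r) + _) =
   \sum_(r < m) (H r (nth [::] vs r) + H (t - z - r.+1) (cmpl (nth [::] vs r)))).
  by lia.
apply: eq_bigr => r _; have rm := ltn_ord r.
rewrite !nth_runners; [|lia..].
rewrite rm ifF ?ifT; [|lia..].
by congr (_ + H _ (cmpl (nth _ _ _))); lia.
Qed.

(** A word and its reversed complement have [2 * M] gaps together, as many as two trivial
    runners. *)
Lemma gaps_weave_runners : gaps (weave t (2 * M) rs) = M * t.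
Proof.
have t0 : 0 < t by lia.
rewrite (gaps_weave t0 size_runners sizes_runners) (big_runners size_runners).
apply: (@addIn (\sum_(r < m) (2 * M))).
have := sum_runners (fun _ => gaps); rewrite !gaps_triv.
rewrite sum_nat_const_nat subn0 mulnC => E.
transitivity (\sum_(0 <= r < t) gaps (nth [::] rs r) + \sum_(r < m) (M + M)).
  by congr (_ + _); apply: eq_bigr => r _; rewrite mul2n addnn.
rewrite E; congr (_ + _); apply: eq_bigr => r _.
by rewrite gaps_cmpl addnC -size_gaps size_nth_vs.
Qed.

Lemma beads_weave_runners : count id (weave t (2 * M) rs) = M * t.
Proof.
have := size_weave t (2 * M) rs; rewrite size_gaps gaps_weave_runners.
by rewrite mul2n -addnn mulnDl => /addIn.
Qed.

Lemma perm_invs_runners :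
  perm_eq [seq h <- invs (weave t (2 * M) rs) | t %| h]
          [seq t * h | h <- flatten [seq invs v ++ invs v | v <- vs]].
Proof.
have t0 : 0 < t by lia.
apply: perm_trans (perm_invs_weave t0 size_runners sizes_runners) _.
apply: perm_map; rewrite /rs /runners !map_cat !flatten_cat.
have nil k : flatten [seq invs v | v <- nseq k (triv M)] = [::].
  by rewrite map_nseq invs_triv; elim: k.
rewrite !nil cats0 /= -map_rev perm_sym.
apply: (@perm_trans _ (flatten [seq invs v | v <- vs] ++ flatten [seq invs v | v <- vs])).
  elim: (vs) => //= v l IH; rewrite -!catA perm_cat2l perm_sym perm_catCA perm_cat2l perm_sym.
  exact: IH.
rewrite perm_cat2l map_rev.
apply: (@perm_trans _ (flatten [seq invs v | v <- map cmpl vs])); last first.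
  by rewrite perm_sym; apply: perm_flatten; rewrite map_rev perm_rev.
elim: (vs) => //= v l IH; apply: perm_cat => //.
by rewrite perm_sym perm_invs_cmpl.
Qed.

End Runners.

(* The exponent of q contributed by a pair of runners, the first of which has
   [G] gaps among [2 * M] positions, i.e. charge [n = G - M]: it is
   [A n + 2 t C(n, 2)], which for [n = - k] reads [(2 t - A) k + 2 t C(k, 2)]. *)
Definition core_weight (t A M G : nat) : nat :=
  if M <= G then A * (G - M) + 2 * t * 'C(G - M, 2)
  else (2 * t - A) * (M - G) + 2 * t * 'C(M - G, 2).

Lemma bin2E n : 2 * 'C(n, 2) + n = n * n.
Proof. by elim: n => // n; rewrite binS bin1; lia. Qed.

Lemma bin2_compl B G M : B + G = 2 * M ->
  'C(B, 2) + 2 * (M * G) + M = 'C(G, 2) + 2 * (M * M) + G.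
Proof.
move=> EBG; have EB : B = 2 * M - G by lia.
have := bin2E B; have := bin2E G; set CB := 'C(B, 2); set CG := 'C(G, 2).
clearbody CB CG; subst B; move: EBG => /= EBG hG hB.
have [k Ek] : exists k, 2 * M = k + G by exists (2 * M - G); lia.
rewrite Ek addnK in hB; nia.
Qed.

(** Both branches of [core_weight] are one polynomial in [n = G - M]; the identity expands it in [G]
    and [M], with the negative terms moved across. *)
Lemma core_weightE t A M G : A <= 2 * t -> G <= 2 * M ->
  core_weight t A M G + A * M + 2 * t * (M * G) + 2 * t * 'C(M, 2) =
  A * G + 2 * t * 'C(G, 2) + 2 * t * (M * M).
Proof.
(* Doubling turns the binomial coefficients into squares and leaves a polynomial identity. *)
move=> At GM; apply/eqP; rewrite -(eqn_pmul2l (isT : 0 < 2)); apply/eqP.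
have h n : 2 * (2 * t * 'C(n, 2)) + 2 * t * n = 2 * t * (n * n).
  by rewrite -bin2E; lia.
have hM := h M; have hG := h G; rewrite /core_weight; case: leqP => MG.
  have hn := h (G - M); have EG : G = M + (G - M) by lia.
  set n := G - M in hn EG *; clearbody n; subst G; nia.
have hn := h (M - G); have EM : M = G + (M - G) by lia.
set n := M - G in hn EM *; clearbody n; subst M.
have [A' EA] : exists A', 2 * t = A + A' by exists (2 * t - A); lia.
have -> : 2 * t - A = A' by lia.
have E1 : 2 * t * n = A * n + A' * n by rewrite EA mulnDl.
nia.
Qed.

(** Adding ['C(M * t, 2)] turns the weight into a gap sum, which splits over the runners; the
    all-trivial configuration has exactly that gap sum, so what remains is the excess of each
    pair. *)
Lemma size_invs_runners t z M vs :
  1 < t -> z < t -> size vs = (t - z) %/ 2 -> all (fun v => size v == 2 * M) vs ->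
  size (invs (weave t (2 * M) (runners t z M vs))) =
  \sum_(r < (t - z) %/ 2)
    (core_weight t (2 * r + z + 1) M (gaps (nth [::] vs r)) +
     2 * t * size (invs (nth [::] vs r))).
Proof.
move=> t1 zt svs ssvs; have t0 : 0 < t by lia.
set m := (t - z) %/ 2 in svs *; set w := weave _ _ _.
have m2 : 2 * m <= t - z by rewrite mulnC leq_divM.
apply: (@addIn 'C(M * t, 2)).
rewrite -{1}(gaps_weave_runners t1 zt svs ssvs) -gap_sumE.
have srs : size (runners t z M vs) = t by exact: size_runners.
have ssrs : all (fun v => size v == 2 * M) (runners t z M vs) by exact: sizes_runners.
rewrite (gap_sum_weave t0 srs ssrs).
have := sum_runners t1 zt svs ssvs (fun r v => t * gap_sum v + r * gaps v).
rewrite -/m /= (_ : \sum_(0 <= r < t) (t * _ + r * gaps (triv M)) = 'C(M * t, 2)).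
  set Y := \sum_(r < m) (t * gap_sum (triv M) + _ + _).
  set W := (X in _ = _ + X -> _).
  have -> : W = \sum_(r < m) (core_weight t (2 * r + z + 1) M (gaps (nth [::] vs r)) +
                 2 * t * size (invs (nth [::] vs r))) + Y.
    rewrite -big_split; apply: eq_bigr => r _ /=; have rm := ltn_ord r.
    set v := nth _ _ _; rewrite !gap_sumE gaps_triv invs_triv add0n.
    rewrite (perm_size (perm_invs_cmpl v)).
    have := size_gaps v; rewrite (size_nth_vs svs ssvs) // gaps_cmpl.
    set G := gaps v; set B := count id v => EBG.
    have := @core_weightE t (2 * r + z + 1) M G; set c := core_weight _ _ _ _.
    move=> /(_ ltac:(lia) ltac:(lia)).
    have := bin2E B; have := bin2E G.
    set CB := 'C(B, 2); set CG := 'C(G, 2); set CM := 'C(M, 2) => hG hB hc.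
    have EB : CB + 2 * (M * G) + M = CG + 2 * (M * M) + G by apply: bin2_compl.
    have {}EB : t * CB + t * (2 * (M * G)) + t * M = t * CG + t * (2 * (M * M)) + t * G.
      by rewrite -!mulnDr EB.
    (* [r'] is the runner paired with [r]. The coefficient [2 * r + z + 1] is [t + r - r'], as [E1]
       and [E2] express without subtraction. *)
    have [r' Er] : exists r', t - z - r.+1 = r' by eexists.
    rewrite Er; have Et : t = r' + z + r + 1 by lia.
    have EGM : G <= 2 * M by lia.
    have -> : B = 2 * M - G by lia.
    have Er1 : r' * (2 * M - G) + r' * G = 2 * (r' * M) by rewrite -mulnDr subnK //; lia.
    have E1 : (2 * r + z + 1) * M + r' * M = t * M + r * M by rewrite Et; lia.
    have E2 : (2 * r + z + 1) * G + r' * G = t * G + r * G by rewrite Et; lia.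
    move: hc E1 E2 Er1 EB; move: (2 * M - G) (2 * r + z + 1) => B' A.
    move: (size (invs v)) (r : nat); clearbody c CB CG CM G; clear; lia.
  by rewrite addnA => /addIn ->; rewrite addnC.
under eq_bigr do rewrite gap_sumE invs_triv gaps_triv add0n.
rewrite big_split sum_nat_const_nat subn0 /= -big_distrl /= bin2_sum.
apply/eqP; rewrite -(eqn_pmul2l (isT : 0 < 2)); apply/eqP.
have h1 := bin2E t; have h2 := bin2E M; have h3 := bin2E (M * t).
have h4 : t * t * (2 * 'C(M, 2) + M) = t * t * (M * M) by rewrite h2.
have h5 : M * (2 * 'C(t, 2) + t) = M * (t * t) by rewrite h1.
nia.
Qed.

(** * Parametrization of BG by tuples of words *)

Section Parametrization.
Variables (t z M : nat).
Hypotheses (t_gt1 : 1 < t) (z_lt : z < t).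
Let m := (t - z) %/ 2.
Let N := M * t.

Definition is_runner_tuple (vs : seq (seq bool)) : bool :=
  (size vs == (t - z) %/ 2) && all (fun v => size v == 2 * M) vs.

Definition BG_partition (vs : seq (seq bool)) : seq nat :=
  part (weave t (2 * M) (runners t z M vs)).

Let m_le : 2 * m <= t - z.
Proof. by rewrite mulnC leq_divM. Qed.
Let m_lt : t - z < 2 * m + 2.
Proof. by rewrite -mulnSr mulnC -ltn_divLR. Qed.

Lemma nth_weave_runners vs a r : is_runner_tuple vs -> a < 2 * M -> r < t ->
  nth true (weave t (2 * M) (runners t z M vs)) (a * t + r) =
  if r < m then nth true (nth [::] vs r) a
  else if (r < t - z) && (t - z - r.+1 < m)
       then ~~ nth true (nth [::] vs (t - z - r.+1)) (2 * M - a.+1)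
       else M <= a.
Proof.
case/andP => /eqP svs ssvs aM rt.
have t0 : 0 < t by lia.
have srs : size (runners t z M vs) = t by exact: size_runners.
have ssrs : all (fun v => size v == 2 * M) (runners t z M vs) by exact: sizes_runners.
rewrite (nth_weave t0 srs ssrs) // nth_runners //.
case: ifP => // rm; case: ifP => [/andP[_ rm2]|_]; last by rewrite nth_triv.
have sz : size (nth [::] vs (t - z - r.+1)) = 2 * M by apply: (size_nth_vs svs ssvs).
by rewrite nth_cmpl sz.
Qed.

Lemma BG_BG_partition vs : is_runner_tuple vs -> BG z t (BG_partition vs).
Proof.
move=> vsP; have /andP[/eqP svs ssvs] := vsP.
apply/(BG_wordP (M := M)) => // [||a r aM rt].
- exact: beads_weave_runners.
- exact: gaps_weave_runners.
rewrite nth_weave_runners //; case: (ltnP r m) => rm.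
  rewrite ifT; last by lia.
  rewrite nth_weave_runners //; [|lia..].
  rewrite ifF; last by lia.
  rewrite ifT; last by lia.
  rewrite negbK; congr (nth _ (nth _ _ _) _); lia.
case: ifP => [/andP[rz rm2]|rm2].
  rewrite ifT; last by lia.
  rewrite nth_weave_runners //; [|lia..].
  by rewrite rm2.
by rewrite ifF //; lia.
Qed.

(** A partition of weight at most [N] fits in the [N] by [N] box, and the first [m] residue classes
    of its word determine the others by [BG_wordP]. *)
Lemma BG_partition_surj s : is_partition s -> sumn s <= N -> BG z t s ->
  exists2 vs, is_runner_tuple vs & s = BG_partition vs.
Proof.
move=> ps sN; have le_size := size_le_sumn ps; have le_head := head_le_sumn s.
have [//|||u [bu gu <-]] := @part_surj s N N; [lia..|].
have su : size u = 2 * M * t by rewrite size_gaps bu gu /N; lia.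
move/(BG_wordP t_gt1 z_lt bu gu) => H.
pose vs := [seq [seq nth true u (a * t + r) | a <- iota 0 (2 * M)] | r <- iota 0 m].
have vsP : is_runner_tuple vs.
  rewrite /is_runner_tuple size_map size_iota eqxx /=.
  by apply/allP => v /mapP[r _ ->]; rewrite size_map size_iota.
have nth_vs r a : r < m -> a < 2 * M -> nth true (nth [::] vs r) a = nth true u (a * t + r).
  move=> rm aM; rewrite (nth_map 0) ?size_iota // (nth_map 0) ?size_iota //.
  by rewrite !nth_iota.
exists vs => //; congr part; apply: (@eq_from_nth _ true).
  by rewrite size_weave su.
move=> k; rewrite su => kN; have t0 : 0 < t by lia.
rewrite (divn_eq k t); have : k %/ t < 2 * M by rewrite ltn_divLR.
have : k %% t < t by rewrite ltn_mod.
move: (k %/ t) (k %% t) => a r rt aM.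
rewrite nth_weave_runners //; case: (ltnP r m) => rm; first by rewrite nth_vs.
case: ifP => [/andP[rz rm2]|rm2]; last by rewrite H // ifF //; lia.
rewrite nth_vs //; last by lia.
by rewrite H // ifT //; lia.
Qed.

Lemma BG_partition_inj vs vs' : is_runner_tuple vs -> is_runner_tuple vs' ->
  BG_partition vs = BG_partition vs' -> vs = vs'.
Proof.
move=> vsP vsP'; have /andP[/eqP svs ssvs] := vsP; have /andP[/eqP svs' ssvs'] := vsP'.
move/part_inj => E; have {}E := E _ _.
have {}E : weave t (2 * M) (runners t z M vs) = weave t (2 * M) (runners t z M vs').
  by apply: E; rewrite ?size_weave ?gaps_weave_runners.
apply: (@eq_from_nth _ [::]); rewrite svs ?svs' // => r rm.
have sv : size (nth [::] vs r) = 2 * M by apply: (size_nth_vs svs ssvs).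
have sv' : size (nth [::] vs' r) = 2 * M by apply: (size_nth_vs svs' ssvs').
apply: (@eq_from_nth _ true); rewrite sv ?sv' // => a aM.
have rt : r < t by have := m_le; rewrite -/m in rm; lia.
have := congr1 (fun w => nth true w (a * t + r)) E.
by rewrite /= !nth_weave_runners // -/m in rm *; rewrite rm.
Qed.

Lemma perm_BG_partitions K : K <= N ->
  perm_eq [seq s <- partitions K | BG z t s]
          [seq BG_partition vs | vs <- lists (words (2 * M)) m
                               & sumn (BG_partition vs) == K].
Proof.
move=> KN.
have memP vs : (vs \in lists (words (2 * M)) m) = is_runner_tuple vs.
  by rewrite mem_lists; congr (_ && _); apply: eq_all => v; rewrite /= mem_words.
apply: uniq_perm.
- by rewrite filter_uniq ?partitions_uniq.
- rewrite map_inj_in_uniq ?filter_uniq ?lists_uniq ?words_uniq // => vs vs'.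
  by rewrite !mem_filter !memP => /andP[_ ?] /andP[_ ?]; apply: BG_partition_inj.
move=> s; rewrite mem_filter mem_partitions; apply/idP/mapP.
  case/and3P => Bs ps /eqP sK.
  have [|vs vsP E] := BG_partition_surj ps _ Bs; first by rewrite sK.
  by exists vs => //; rewrite mem_filter memP vsP -E sK eqxx.
case=> vs; rewrite mem_filter memP => /andP[/eqP sK vsP] ->.
by rewrite sK eqxx BG_BG_partition // part_is_partition.
Qed.

End Parametrization.

(** A partition of [k] has at most [k] rows and parts at most [k], so it fits in the box of [L - G]
    rows and [G] columns. *)
Lemma perm_box_partitions L G k : k <= G -> k <= L - G -> G <= L ->
  perm_eq (partitions k)
          [seq part v | v <- words L & (gaps v == G) && (size (invs v) == k)].
Proof.
move=> kG kB GL; apply: uniq_perm; first exact: partitions_uniq.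
  rewrite map_inj_in_uniq ?filter_uniq ?words_uniq // => u v.
  rewrite !mem_filter !mem_words => /andP[/andP[/eqP gu _] /eqP su].
  by move=> /andP[/andP[/eqP gv _] /eqP sv]; apply: part_inj; rewrite ?gu ?gv ?su.
move=> s; rewrite mem_partitions; apply/andP/mapP => [[ps /eqP sk]|[v]].
  have le_size := size_le_sumn ps; have le_head := head_le_sumn s.
  rewrite sk in le_size le_head.
  have [//|||u [bu gu pu]] := @part_surj s (L - G) G.
  - exact: leq_trans kB.
  - exact: leq_trans kG.
  exists u => //; rewrite mem_filter mem_words -sumn_part pu sk gu !eqxx /=.
  by rewrite size_gaps bu gu subnK.
rewrite mem_filter -sumn_part => /andP[/andP[_ /eqP sk] _] ->.
by rewrite part_is_partition sk eqxx.
Qed.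

Local Open Scope ring_scope.

(** * The Jacobi triple product *)

Lemma wordsS L :
  words L.+1 = map (cons true) (words L) ++ map (cons false) (words L).
Proof. by rewrite /words /= cats0. Qed.

(** The sum over words is a Gaussian binomial coefficient, stated with its denominator cleared.
    Splitting on the first letter gives the q-Pascal recurrence: a leading bead forms a pair with
    every gap. *)
Lemma qbinomial_words (A : comNzRingType) (p : A) B G :
  (\sum_(v <- words (B + G) | gaps v == G) p ^+ size (invs v)) *
    \prod_(j < G) (1 - p ^+ j.+1) =
  \prod_(j < G) (1 - p ^+ (B + j.+1)).
Proof.
have [n] := ubnP (B + G)%N; elim: n B G => // n IH B G; rewrite ltnS => le_n.
case: G le_n => [|G] le_n.
  rewrite !big_ord0 mulr1 addn0 {n IH le_n}; elim: B => [|B IH].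
    by rewrite big_cons big_nil /= addr0.
  rewrite wordsS big_cat !big_map /=.
  rewrite [X in _ + X]big1 ?addr0; last by move=> v; rewrite gaps_cons.
  rewrite -[RHS]IH; apply: eq_big => [v|v]; first by rewrite gaps_cons.
  by rewrite gaps_cons add0n => /eqP g0; rewrite size_cat size_map size_gap_positions g0.
rewrite addnS wordsS big_cat !big_map /=.
under eq_bigl do rewrite gaps_cons add0n.
under [X in _ + X]eq_bigl do rewrite gaps_cons add1n eqSS.
rewrite mulrDl [X in _ + _ * X]big_ord_recr /= [X in _ + X]mulrA IH; last first.
  by rewrite addnS in le_n.
case: B le_n => [|B] le_n.
  rewrite big_seq_cond big1 ?mul0r ?add0r; last first.
    move=> v; rewrite mem_words => /andP[/eqP sv /eqP gv].
    by have := size_gaps v; rewrite sv gv; lia.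
  by rewrite [RHS]big_ord_recr.
rewrite (eq_bigr (fun v => p ^+ G.+1 * p ^+ size (invs v))); last first.
  by move=> v /eqP gv; rewrite size_cat size_map size_gap_positions gv exprD.
rewrite -big_distrr -mulrA addSnnS /= IH; last by lia.
rewrite [X in p ^+ _ * X]big_ord_recl [RHS]big_ord_recr /=.
rewrite (eq_bigr (fun j : 'I_G => 1 - p ^+ (B.+1 + j.+1))); last first.
  by move=> j _; rewrite /bump /= add1n addnS addSn.
rewrite addn1 [(B.+1 + G.+1)%N]addnC exprD.
by set P := \prod_(j < G) _; ring.
Qed.

Section JacobiTriple.
Variables (t A M : nat).
Hypothesis A_bounds : (0 < A < 2 * t)%N.

(** By truncated subtraction the left side is the absolute value of the charge; large charges thus
    only contribute in high degree. *)
Lemma core_weight_ge G : ((G - M) + (M - G) <= core_weight t A M G)%N.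
Proof.
rewrite /core_weight; case: (leqP M G) => MG; apply: (leq_trans _ (leq_addr _ _)).
  have : (G - M <= A * (G - M))%N by apply: leq_pmull; lia.
  lia.
have : (M - G <= (2 * t - A) * (M - G))%N by apply: leq_pmull; lia.
lia.
Qed.

(** [X] is the energy of a gap and [Y] that of a bead; they vanish where [triv M] has that letter,
    so the trivial word has energy 0. *)
Let X (a : nat) : nat := if (a < M)%N then 0%N else (A + 2 * t * (a - M))%N.
Let Y (a : nat) : nat :=
  if (a < M)%N then (2 * t - A + 2 * t * (M - a.+1))%N else 0%N.

Lemma core_weight_energy v : size v = (2 * M)%N ->
  (\sum_(a < 2 * M) (if nth true v a then Y a else X a) =
   core_weight t A M (gaps v) + 2 * t * size (invs v))%N.
Proof.
move=> sv.
have EA := @core_weightE t A M (gaps v).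
have {}EA := EA ltac:(lia) ltac:(by rewrite -sv size_gaps leq_addl).
have S : (\sum_(a < 2 * M) (if nth true v a then Y a else X a) +
   2 * t * M * gaps v + (A * M + 2 * t * 'C(M, 2)) =
   A * gaps v + 2 * t * gap_sum v + 2 * t * M * M)%N.
  have W (F : nat -> nat) :
    (\sum_(a < 2 * M) (if (a < M)%N then F a else 0) = \sum_(0 <= a < M) F a)%N.
    by rewrite big_mkord (big_ord_widen (2 * M)) ?leq_pmull // [RHS]big_mkcond.
  have H1 : (A * M + 2 * t * 'C(M, 2) =
             \sum_(a < 2 * M) (if (a < M)%N then A + 2 * t * a else 0))%N.
    rewrite (W (fun a => A + 2 * t * a)%N) big_split sum_nat_const_nat subn0.
    by rewrite -big_distrr bin2_sum /= mulnC.
  have H2 : (2 * t * M * M = \sum_(a < 2 * M) (if (a < M)%N then 2 * t * M else 0))%N.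
    by rewrite (W (fun=> 2 * t * M)%N) sum_nat_const_nat subn0 mulnC.
  rewrite H1 H2 gaps_nth /gap_sum sv !big_mkord !big_distrr -!big_split /=.
  apply: eq_bigr => a _; rewrite /X /Y.
  by case: (nth true v a); case: ltnP => aM /=; rewrite ?muln0 ?muln1 ?mul1n ?mul0n ?muln0; nia.
rewrite gap_sumE in S; lia.
Qed.

(** The exponent is a sum of energies over positions, so the sum over all words factors: positions
    from [M] on give the first product, those below [M] the second. *)
Lemma finite_jacobi_triple (R : comNzRingType) (q : R) :
  \sum_(v <- words (2 * M))
    q ^+ core_weight t A M (gaps v) * (q ^+ (2 * t)) ^+ size (invs v) =
  (\prod_(k < M) (1 + q ^+ A * (q ^+ (2 * t)) ^+ k)) *
  (\prod_(k < M) (1 + q ^+ (2 * t - A) * (q ^+ (2 * t)) ^+ k)).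
Proof.
pose F (a : nat) (b : bool) := q ^+ (if b then Y a else X a).
transitivity (\sum_(v <- words (2 * M)) \prod_(a < 2 * M) F a (nth true v a)).
  rewrite big_seq [RHS]big_seq; apply: eq_bigr => v; rewrite mem_words => /eqP sv.
  by rewrite /F prodrXr core_weight_energy // exprD -exprM.
rewrite /words sum_lists_prod mul2n -addnn big_split_ord /= mulrC; congr (_ * _).
  apply: eq_bigr => k _; rewrite !big_cons big_nil /F /X /Y /= addr0.
  by rewrite ltnNge leq_addr /= addKn exprD exprM expr0.
(* The lower half is read backwards: the bead at [M - k.+1] has energy [2 * t - A + 2 * t * k]. *)
rewrite -(big_mkord xpredT (fun k => \sum_(b <- [:: true; false]) F k b)) big_rev_mkord subn0.
apply: eq_bigr => k _; rewrite !big_cons big_nil /F /X /Y /= addr0.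
have kM := ltn_ord k; have -> : (M - k.+1 < M)%N by lia.
rewrite expr0 addrC exprD exprM; congr (_ + _ * _ ^+ _); lia.
Qed.

End JacobiTriple.

(** * Congruence of power series modulo q^(K+1) *)

Definition eqmod (A : comNzRingType) (K : nat) (f g : fps A) : Prop :=
  forall n, (n <= K)%N -> f n = g n.

Section Eqmod.
Variables (A : comNzRingType) (K : nat).
Implicit Types f g : fps A.

Lemma eqmod_trans f g h : eqmod K f g -> eqmod K g h -> eqmod K f h.
Proof. by move=> fg gh n nK; rewrite fg ?gh. Qed.

Lemma eqmodD f f' g g' : eqmod K f f' -> eqmod K g g' -> eqmod K (f + g) (f' + g').
Proof. by move=> ff gg n nK; rewrite -[LHS]/(f n + g n) ff ?gg. Qed.

Lemma eqmodM f f' g g' : eqmod K f f' -> eqmod K g g' -> eqmod K (f * g) (f' * g').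
Proof.
move=> ff gg n nK; rewrite !coef_fpsM; apply: eq_bigr => i _.
by rewrite ff ?gg // ?(leq_trans (leq_subr _ _)) // (leq_trans _ nK) // -ltnS.
Qed.

Lemma eqmod_sum I (r : seq I) (P : pred I) (F G : I -> fps A) :
  (forall i, P i -> eqmod K (F i) (G i)) ->
  eqmod K (\sum_(i <- r | P i) F i) (\sum_(i <- r | P i) G i).
Proof. by move=> FG; apply: big_ind2 => //; exact: eqmodD. Qed.

Lemma eqmod_prod I (r : seq I) (P : pred I) (F G : I -> fps A) :
  (forall i, P i -> eqmod K (F i) (G i)) ->
  eqmod K (\prod_(i <- r | P i) F i) (\prod_(i <- r | P i) G i).
Proof. by move=> FG; apply: big_ind2 => //; exact: eqmodM. Qed.

Lemma eqmod_mul0 f g g' : eqmod K f 0 -> eqmod K (f * g) (f * g').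
Proof.
move=> f0; apply: (@eqmod_trans _ (0 * g)); first by apply: eqmodM.
by rewrite mul0r -(mul0r g') => n nK; apply/esym; move: n nK; apply: eqmodM.
Qed.

Lemma eqmod_exp0 (p : fps A) k : p 0%N = 0 -> (K < k)%N -> eqmod K (p ^+ k) 0.
Proof. by move=> p0 Kk n nK; rewrite coef_fpsX_exp // (leq_ltn_trans nK). Qed.

Lemma coef_fps_sum I (r : seq I) (P : pred I) (F : I -> fps A) n :
  (\sum_(i <- r | P i) F i) n = \sum_(i <- r | P i) F i n.
Proof. exact: (big_morph (fun f : fps A => f n)). Qed.

Lemma coef_mul_fpsC f c n : (f * fpsC c) n = f n * c.
Proof.
rewrite coef_fpsM big_ord_recr /= subnn big1 ?add0r // => i _.
by rewrite gtn_eqF ?mulr0 // subn_gt0.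
Qed.

Lemma fpsCM : {morph @fpsC A : a b / a * b}.
Proof.
by move=> a b; apply/fpsP => n; rewrite coef_mul_fpsC /=; case: eqP; rewrite ?mul0r.
Qed.

Lemma fpsCD : {morph @fpsC A : a b / a + b}.
Proof.
move=> a b; apply/fpsP => n; rewrite -[RHS]/(fpsC a n + fpsC b n) /=.
by case: eqP; rewrite ?addr0.
Qed.

Lemma fpsC0 : fpsC (0 : A) = 0.
Proof. by apply/fpsP => n /=; rewrite if_same. Qed.

Lemma fpsC1 : fpsC (1 : A) = 1.
Proof. by apply/fpsP => n /=; case: eqP. Qed.

Lemma fpsX0 k : (0 < k)%N -> (fpsX ^+ k : fps A) 0%N = 0.
Proof. by move=> k0; apply: coef_fpsX_exp. Qed.

Lemma coef_fpsXn k n : (fpsX ^+ k : fps A) n = (n == k)%:R.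
Proof.
elim: k n => // k IH n; rewrite exprS coef_fpsM.
case: n => [|n]; first by rewrite big_ord_recl big_ord0 /= mul0r addr0.
rewrite big_ord_recl big_ord_recl /= mul0r add0r mul1r IH subSS subn0 eqSS.
by rewrite big1 ?addr0 // => i _; rewrite mul0r.
Qed.

Lemma qpoch_eqmod (a p : fps A) N : p 0%N = 0 -> (K < N)%N ->
  eqmod K (\prod_(j < N) (1 - a * p ^+ j)) (qpoch a p).
Proof. by move=> p0 KN n nK; rewrite qpochE // (leq_ltn_trans nK). Qed.

(** The q-binomial tends to the inverse of [qpoch p p]: with [L - G >= K] beads, each numerator
    factor is 1 modulo q^(K+1). *)
Lemma qbinomial_eqmod (p : fps A) L G : p 0%N = 0 -> (K < G)%N -> (K + G <= L)%N ->
  eqmod K ((\sum_(v <- words L | gaps v == G) p ^+ size (invs v)) * qpoch p p) 1.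
Proof.
move=> p0 KG KL; have EL : L = ((L - G) + G)%N by lia.
rewrite {}EL; set B := (L - G)%N.
apply: (@eqmod_trans _ ((\sum_(v <- words (B + G) | gaps v == G) p ^+ size (invs v)) *
                        \prod_(j < G) (1 - p * p ^+ j))).
  apply: eqmodM => // n nK; apply/esym; move: n nK; exact: qpoch_eqmod.
rewrite [X in _ * X](eq_bigr (fun j : 'I_G => 1 - p ^+ j.+1)); last by move=> j _; rewrite exprS.
rewrite qbinomial_words; apply: (@eqmod_trans _ (\prod_(j < G) 1)); last by rewrite big1_eq.
apply: eqmod_prod => j _ n nK; rewrite -[LHS]/(_ - _) coef_fpsX_exp ?subr0 //.
by rewrite addnS ltnS (leq_trans nK) // /B; lia.
Qed.

End Eqmod.

(** * Generating series *)

Lemma sum_by_value (V : nmodType) (T : eqType) (s : seq T) (p : T -> nat) n (F : T -> V) :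
  (forall v, v \in s -> (p v < n)%N) ->
  \sum_(v <- s) F v = \sum_(j < n) \sum_(v <- s | p v == j) F v.
Proof.
move=> pn; rewrite (exchange_big_dep xpredT) //= big_seq [RHS]big_seq.
apply: eq_bigr => v /pn vn; by rewrite (big_pred1 (Ordinal vn)) // => j.
Qed.

Section BoxSums.
Variables (R : comNzRingType) (w : seq nat -> R) (u : fps {poly R}) (K : nat).
Hypothesis u0 : u 0%N = 0.

Definition word_term (v : seq bool) : fps {poly R} :=
  u ^+ size (invs v) * fpsC (w (part v))%:P.

(** Words with more than [n] pairs do not reach degree [n], as [u] has no constant term; the others
    run over all partitions of each size up to [n]. *)
Lemma box_sum_eqmod L G : (K <= G)%N -> (K + G <= L)%N ->
  eqmod K (\sum_(v <- words L | gaps v == G) word_term v)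
          (fps_subst (partition_series predT w) u).
Proof.
move=> KG KL n nK; rewrite coef_fps_sum.
transitivity (\sum_(k < n.+1) \sum_(v <- words L | (gaps v == G) && (size (invs v) == k))
    w (part v) *: (u ^+ k) n); last first.
  rewrite [RHS]/=; apply: eq_bigr => k _; rewrite -scaler_suml; congr (_ *: _).
  have kn := ltn_ord k.
  rewrite (perm_big _ (@perm_box_partitions L G k _ _ _)) /=; [|lia..].
  by rewrite big_map big_filter.
rewrite (exchange_big_dep (fun v => gaps v == G)); last by move=> k v _ /andP[].
apply: eq_bigr => v gv; rewrite /word_term coef_mul_fpsC mulrC mul_polyC.
under [RHS]eq_bigl do rewrite gv /=.
case: (ltnP (size (invs v)) n.+1) => vn; last first.
  rewrite coef_fpsX_exp // scaler0 big1 // => k /eqP vk.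
  by have := ltn_ord k; rewrite -vk ltnNge vn.
by rewrite (big_pred1 (Ordinal vn)) // => j; rewrite -val_eqE eq_sym.
Qed.

Variables (t A : nat).
Hypothesis A_bounds : (0 < A < 2 * t)%N.
Let q : fps {poly R} := fpsX.
Let p : fps {poly R} := q ^+ (2 * t).
(** Chosen so that a charge of absolute value at most [K] gives [K < G] and [K + G <= 2 * M]. *)
Let M := (2 * K).+1.

Let p0 : p 0%N = 0.
Proof. by apply: fpsX0; lia. Qed.

(** Either the charge is at most [K] in absolute value and the box is large enough, or the power of
    [q] in front is 0 modulo q^(K+1). *)
Let close_or_small G (F F' : fps {poly R}) :
  ((K < G)%N -> (K + G <= 2 * M)%N -> eqmod K F F') ->
  eqmod K (q ^+ core_weight t A M G * F) (q ^+ core_weight t A M G * F').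
Proof.
move=> FF; have := core_weight_ge M A_bounds G.
case: (leqP ((G - M) + (M - G)) K) => GK cG.
  by apply: eqmodM => //; apply: FF; rewrite /M in GK *; lia.
by apply: eqmod_mul0; apply: eqmod_exp0; rewrite ?(leq_trans GK).
Qed.

Lemma sum_words_core (F : seq bool -> fps {poly R}) :
  \sum_(v <- words (2 * M)) q ^+ core_weight t A M (gaps v) * F v =
  \sum_(G < (2 * M).+1)
    q ^+ core_weight t A M G * \sum_(v <- words (2 * M) | gaps v == G) F v.
Proof.
rewrite (@sum_by_value _ _ _ gaps (2 * M).+1); last first.
  by move=> v; rewrite mem_words ltnS size_gaps => /eqP <-; apply: leq_addl.
by apply: eq_bigr => G _; rewrite big_distrr /=; apply: eq_bigr => v /eqP ->.
Qed.

(** The finite triple product, grouped by charge, is multiplied by [qpoch p p], which cancels the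
    q-binomial at every relevant charge. *)
Lemma theta_eqmod :
  eqmod K (\sum_(G < (2 * M).+1) q ^+ core_weight t A M G)
          (qpoch (- q ^+ A) p * qpoch (- q ^+ (2 * t - A)) p * qpoch p p).
Proof.
have KM : (K < M)%N by rewrite /M; lia.
have jtp := finite_jacobi_triple M A_bounds q; rewrite sum_words_core in jtp.
move=> n nK; apply/esym; move: n nK.
apply: (@eqmod_trans _ _ _ ((\prod_(k < M) (1 + q ^+ A * p ^+ k)) *
                 (\prod_(k < M) (1 + q ^+ (2 * t - A) * p ^+ k)) * qpoch p p)).
  have qp B : eqmod K (qpoch (- q ^+ B) p) (\prod_(k < M) (1 + q ^+ B * p ^+ k)).
    move=> n nK; rewrite -(@qpochE _ _ _ n M) ?(leq_ltn_trans nK) //.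
    by congr (fps_coef _ _); apply: eq_bigr => k _; rewrite mulNr opprK.
  by apply: eqmodM => //; apply: eqmodM; apply: qp.
rewrite -jtp mulr_suml; apply: eqmod_sum => G _.
rewrite -mulrA -[X in eqmod _ _ X]mulr1; apply: close_or_small => KG GM.
exact: qbinomial_eqmod.
Qed.

(** At every relevant charge the inner sum is the same series in [u], which therefore factors out of
    the theta series. *)
Lemma runner_sum_eqmod :
  eqmod K (\sum_(v <- words (2 * M)) q ^+ core_weight t A M (gaps v) * word_term v)
          (qpoch (- q ^+ A) p * qpoch (- q ^+ (2 * t - A)) p * qpoch p p *
           fps_subst (partition_series predT w) u).
Proof.
rewrite sum_words_core.
apply: (@eqmod_trans _ _ _ (\sum_(G < (2 * M).+1) q ^+ core_weight t A M G *
           fps_subst (partition_series predT w) u)).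
  apply: eqmod_sum => G _; apply: close_or_small => KG GM.
  by apply: box_sum_eqmod => //; apply: ltnW.
by rewrite -mulr_suml; apply: eqmodM => //; exact: theta_eqmod.
Qed.

End BoxSums.

Lemma big_hooks_part (V : Type) (idx : V) (op : Monoid.com_law idx) (F : nat -> V) v :
  \big[op/idx]_(h <- hooks (part v)) F h = \big[op/idx]_(h <- invs v) F h.
Proof. exact: (perm_big _ (perm_hooks_part v)). Qed.

Lemma big_hooks_mult_BG (V : Type) (idx : V) (op : Monoid.com_law idx)
    (F : nat -> V) t z M vs :
  (1 < t)%N -> (z < t)%N -> is_runner_tuple t z M vs ->
  \big[op/idx]_(h <- hooks_mult t (BG_partition t z M vs)) F h =
  \big[op/idx]_(r < (t - z) %/ 2)
     (op (\big[op/idx]_(h <- invs (nth [::] vs r)) F (t * h)%N)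
         (\big[op/idx]_(h <- invs (nth [::] vs r)) F (t * h)%N)).
Proof.
move=> t1 zt /andP[/eqP svs ssvs].
have hp : perm_eq (hooks_mult t (BG_partition t z M vs))
                  [seq (t * h)%N | h <- flatten [seq invs v ++ invs v | v <- vs]].
  apply: perm_trans (perm_invs_runners t1 zt svs ssvs).
  exact: (perm_filter _ (perm_hooks_part _)).
rewrite (perm_big _ hp) big_map big_flatten big_map (big_nth [::]) svs big_mkord.
by apply: eq_bigr => r _; rewrite big_cat.
Qed.

(** * The generating series of BG *)

Section Main.
Variables (R : comNzRingType) (t z : nat) (rho1 rho2 : nat -> R).
Hypotheses (t_gt1 : (1 < t)%N) (z_lt : (z < t)%N).
Let m := ((t - z) %/ 2)%N.
Let q : fps {poly R} := fpsX.
Let u : fps {poly R} := fpsC ('X ^+ 2) * q ^+ (2 * t).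
Let wf (s : seq nat) : R := \prod_(h <- hooks s) rho1 (t * h)%N ^+ 2.
Let wg (s : seq nat) : R := wf s * \sum_(h <- hooks s) rho2 (t * h)%N.
Let BG_weight (s : seq nat) : {poly R} :=
  ((\prod_(h <- hooks_mult t s) rho1 h) * (\sum_(h <- hooks_mult t s) rho2 h))
    *: 'X^(size (hooks_mult t s)).

(** Each hook of a word occurs twice among the hooks divisible by [t], scaled by [t], and costs
    [2 * t] in weight: this gives [u], the square of [rho1] and the factor 2 before [rho2]. *)
Lemma BG_weight_runners M vs : is_runner_tuple t z M vs ->
  q ^+ sumn (BG_partition t z M vs) * fpsC (BG_weight (BG_partition t z M vs)) =
  (\prod_(r < m) (q ^+ core_weight t (2 * r + z + 1) M (gaps (nth [::] vs r)) *
                  word_term wf u (nth [::] vs r))) *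
  \sum_(r < m) fpsC (2 * \sum_(h <- invs (nth [::] vs r)) rho2 (t * h)%N)%:P.
Proof.
move=> vsP; have /andP[/eqP svs ssvs] := vsP.
have fpsC_prod (F : 'I_m -> {poly R}) : \prod_(r < m) fpsC (F r) = fpsC (\prod_(r < m) F r).
  by symmetry; apply: (big_morph (@fpsC {poly R})); [exact: fpsCM | exact: fpsC1].
have fpsC_sum (F : 'I_m -> {poly R}) : \sum_(r < m) fpsC (F r) = fpsC (\sum_(r < m) F r).
  by symmetry; apply: (big_morph (@fpsC {poly R})); [exact: fpsCD | exact: fpsC0].
rewrite fpsC_sum -rmorph_sum.
have -> : \prod_(r < m) (q ^+ core_weight t (2 * r + z + 1) M (gaps (nth [::] vs r)) *
                         word_term wf u (nth [::] vs r)) =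
  q ^+ size (invs (weave t (2 * M) (runners t z M vs))) *
  fpsC 'X^(size (hooks_mult t (BG_partition t z M vs))) *
  fpsC (\prod_(h <- hooks_mult t (BG_partition t z M vs)) rho1 h)%:P.
  have -> : size (hooks_mult t (BG_partition t z M vs)) =
            (\sum_(r < m) 2 * size (invs (nth [::] vs r)))%N.
    rewrite -sum1_size big_hooks_mult_BG //; apply: eq_bigr => r _.
    by rewrite /= !sum1_size mul2n addnn.
  rewrite big_hooks_mult_BG // size_invs_runners // -/m.
  rewrite -!prodrXr rmorph_prod -!fpsC_prod -!big_split /=.
  apply: eq_bigr => r _; rewrite /word_term.
  have -> : wf (part (nth [::] vs r)) = (\prod_(h <- invs (nth [::] vs r)) rho1 (t * h)%N) *
            (\prod_(h <- invs (nth [::] vs r)) rho1 (t * h)%N).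
    by rewrite /wf big_hooks_part prodrXl expr2.
  rewrite /u exprMn -exprM exprD !mulrA; congr (_ * _).
  rewrite -!mulrA; congr (_ * _); rewrite mulrC; congr (_ * _).
  rewrite exprM; elim: (size _) => [|k IH]; first by rewrite !expr0 fpsC1.
  by rewrite exprS IH -fpsCM -exprS.
have -> : \sum_(r < m) 2 * (\sum_(h <- invs (nth [::] vs r)) rho2 (t * h)%N) =
          \sum_(h <- hooks_mult t (BG_partition t z M vs)) rho2 h.
  by rewrite big_hooks_mult_BG //; apply: eq_bigr => r _; rewrite mulr_natl mulr2n.
rewrite /BG_weight -mul_polyC rmorphM /= !fpsCM /BG_partition sumn_part; ring.
Qed.

Let theta (i : nat) : fps {poly R} :=
  qpoch (- q ^+ (2 * i + z + 1)) (q ^+ (2 * t)) *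
  qpoch (- q ^+ (2 * t - (2 * i + z + 1))) (q ^+ (2 * t)) *
  qpoch (q ^+ (2 * t)) (q ^+ (2 * t)).

Lemma BG_series_product :
  BG_series z t rho1 rho2 =
  (2 * m)%:R * fps_subst (f_series t rho1) u ^+ (m - 1) *
    fps_subst (g_series t rho1 rho2) u * \prod_(i < m) theta i.
Proof.
(* Coefficient by coefficient; this is the [M] of [runner_sum_eqmod], and it also puts [K] below
   [M * t], so every partition of [K] is parametrized. *)
apply/fpsP => K; pose M := (2 * K).+1.
have m_le : (2 * m <= t - z)%N by rewrite mulnC leq_divM.
have u0 : u 0%N = 0.
  by rewrite /u mulrC coef_mul_fpsC fpsX0 ?mul0r //; lia.
have A_bounds r : (r < m)%N -> (0 < 2 * r + z + 1 < 2 * t)%N by lia.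
pose W w r := \sum_(v <- words (2 * M))
   q ^+ core_weight t (2 * r + z + 1) M (gaps v) * word_term w u v.
have WE w r : (r < m)%N ->
    eqmod K (W w r) (theta r * fps_subst (partition_series predT w) u).
  by move=> rm; apply: runner_sum_eqmod => //; exact: A_bounds.
have -> : BG_series z t rho1 rho2 K =
    (\sum_(j < m) (2 * W wg j) * \prod_(r < m | r != j) W wf r) K.
  have KN : (K <= M * t)%N by rewrite /M; nia.
  rewrite /= -big_filter (perm_big _ (perm_BG_partitions t_gt1 z_lt KN)) big_map big_filter.
  rewrite -/(BG_weight _).
  transitivity ((\sum_(vs <- lists (words (2 * M)) m)
     q ^+ sumn (BG_partition t z M vs) * fpsC (BG_weight (BG_partition t z M vs))) K).
    rewrite coef_fps_sum big_mkcond; apply: eq_bigr => vs _.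
    rewrite coef_mul_fpsC coef_fpsXn [K == _]eq_sym.
    by case: eqP; rewrite ?mul1r ?mul0r.
  congr (fps_coef _ K).
  pose F r v := q ^+ core_weight t (2 * r + z + 1) M (gaps v) * word_term wf u v.
  pose D v : fps {poly R} := fpsC (2 * \sum_(h <- invs v) rho2 (t * h)%N)%:P.
  transitivity (\sum_(vs <- lists (words (2 * M)) m)
     (\prod_(r < m) F r (nth [::] vs r)) * (\sum_(r < m) D (nth [::] vs r))).
    rewrite big_seq [RHS]big_seq; apply: eq_bigr => vs.
    rewrite mem_lists => vsP; rewrite BG_weight_runners //.
    rewrite /is_runner_tuple -/m; apply: etrans vsP; congr (_ && _).
    by apply: eq_all => v; rewrite /= mem_words.
  rewrite sum_lists_prod_sum; apply: eq_bigr => j _; congr (_ * _).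
  rewrite /W big_distrr /=; apply: eq_bigr => v _.
  rewrite /F /D /word_term /wg big_hooks_part !rmorphM /= !fpsCM rmorph_nat.
  have -> : fpsC (2 : {poly R}) = 2.
    by rewrite -[2 in LHS]/(1 + 1) fpsCD fpsC1.
  ring.
have -> : f_series t rho1 = partition_series predT wf by [].
have -> : g_series t rho1 rho2 = partition_series predT wg by [].
set f := fps_subst _ u; set g := fps_subst _ u.
transitivity ((\sum_(j < m) (2 * (theta j * g)) *
                \prod_(r < m | r != j) (theta r * f)) K).
  apply: (_ : eqmod K _ _) => //; apply: eqmod_sum => j _; apply: eqmodM.
    by apply: eqmodM => //; apply: WE.
  by apply: eqmod_prod => r _; apply: WE.
congr (fps_coef _ K).
(* The term of [j] no longer depends on [j]: one factor [g], [m - 1] factors [f] and all the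
   [theta]. Summing over [j] gives the coefficient [2 * m]. *)
rewrite (eq_bigr (fun=> 2 * f ^+ (m - 1) * g * \prod_(i < m) theta i)); last first.
  move=> j _; rewrite big_split prodr_const /= [in RHS](bigD1 j) //=.
  have -> : #|[pred r : 'I_m | r != j]| = (m - 1)%N.
    by rewrite cardC1 card_ord subn1.
  ring.
by rewrite sumr_const card_ord -mulr_natl natrM; ring.
Qed.

End Main.

(* When m = 0 the right-hand side is 0 because of the factor 2 * m, so the
   truncation of the exponent m - 1 plays no role. *)
Theorem theorem1p9 (R : comNzRingType) (t z : nat) (rho1 rho2 : nat -> R) :
  (2 <= t)%N -> (z <= t - 1)%N ->
  let m := ((t - z) %/ 2)%N in
  let q := @fpsX {poly R} in
  let u := fpsC ('X ^+ 2) * q ^+ (2 * t) in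
  BG_series z t rho1 rho2 =
    (2 * m)%:R
    * fps_subst (f_series t rho1) u ^+ (m - 1)
    * fps_subst (g_series t rho1 rho2) u
    * \prod_(i < m)
        (qpoch (- q ^+ (2 * i + z + 1)) (q ^+ (2 * t))
         * qpoch (- q ^+ (2 * t - 2 * i - z - 1)) (q ^+ (2 * t))
         * qpoch (q ^+ (2 * t)) (q ^+ (2 * t))).
Proof.
move=> t2 zt m q u; rewrite (BG_series_product rho1 rho2 t2); last by lia.
congr (_ * _); apply: eq_bigr => i _.
by rewrite (_ : 2 * t - 2 * i - z - 1 = 2 * t - (2 * i + z + 1))%N //; lia.
Qed.
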